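(* Let $P,Q\subseteq\mathbb{R}^d$ be rational polytopes of the same dimension $D=\dim P=\dim Q$ with $P\subseteq Q$, and let $g$ be a common multiple of the denominators $\delta(P)$ and $\delta(Q)$. Then for every weight $w\in S_Q$ that is homogeneous of degree $m$, \[(1+t^{\delta(P)}+\cdots+t^{g-\delta(P)})^{D+m+1}h^*_{P,w}(t)\le(1+t^{\delta(Q)}+\cdots+t^{g-\delta(Q)})^{D+m+1}h^*_{Q,w}(t)\quad\text{for all real }t\ge 0.\] In particular, if $\delta(P)=\delta(Q)$, then $h^*_{P,w}(t)\le h^*_{Q,w}(t)$ for all $t\ge 0$.
   Context: For a rational polytope $P\subseteq\mathbb{R}^d$, $\mathrm{C}(P)=\{c(p,1)\mid c\ge0,\ p\in P\}\subseteq\mathbb{R}^{d+1}$ and $\delta(P)$ is the smallest positive integer $q$ such that $qP$ has vertices in $\mathbb{Z}^d$. For a polynomial $w$ on $\mathbb{R}^{d+1}$, $\mathrm{Ehr}(P,w;t)=\sum_{x\in\mathrm{C}(P)\cap\mathbb{Z}^{d+1}}w(x)t^{x_{d+1}}$; for $w$ homogeneous of degree $m$, $h^*_{P,w}(t)$ is the polynomial with $\mathrm{Ehr}(P,w;t)=h^*_{P,w}(t)/(1-t^{\delta(P)})^{\dim P+m+1}$. $S_Q$ is the semiring of sums of products of linear forms on $\mathbb{R}^{d+1}$ where each such product is nonnegative on $\mathrm{C}(Q)$. *)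

(* Defs.v *)
From HB Require Import structures.
From mathcomp Require Import all_boot all_order all_algebra.
From mathcomp Require Import finmap mpoly.
From mathcomp Require Import boolp classical_sets functions cardinality fsbigop.
From mathcomp Require Import reals.

Set Implicit Arguments.
Unset Strict Implicit.
Unset Printing Implicit Defensive.

Import Order.TTheory GRing.Theory Num.Theory.

Local Open Scope classical_set_scope.
Local Open Scope ring_scope.

Notation weight R d := {mpoly R[d + 1]}.

Section Polytopes.
Variables (R : realType) (d : nat).
Implicit Types (P : set 'rV[R]_d) (v : 'rV[R]_d).

Definition integral_pt (n : nat) (x : 'rV[R]_n) : Prop :=
  forall i, x 0 i \is a Num.int.

Definition rational_pt (n : nat) (x : 'rV[R]_n) : Prop :=
  forall i, exists q : rat, x 0 i = ratr q.

Definition conv_hull (k : nat) (p : 'I_k -> 'rV[R]_d) : set 'rV[R]_d :=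
  [set x | exists a : 'I_k -> R,
    [/\ forall i, 0 <= a i, \sum_i a i = 1 & x = \sum_i a i *: p i]].

(* Polytopes are nonempty: the generating family has k.+1 members. *)
Definition rational_polytope P : Prop :=
  exists (k : nat) (p : 'I_k.+1 -> 'rV[R]_d),
    (forall i, rational_pt (p i)) /\ P = conv_hull p.

Definition affine_hull P : set 'rV[R]_d :=
  [set x | exists (k : nat) (p : 'I_k -> 'rV[R]_d) (a : 'I_k -> R),
    [/\ forall i, P (p i), \sum_i a i = 1 & x = \sum_i a i *: p i]].

(* The dimension of a nonempty P is that of the direction space U of its
   affine hull p + U. *)
Definition is_dim P (D : nat) : Prop :=
  exists (p : 'rV[R]_d) (U : {vspace 'rV[R]_d}),
    affine_hull P = [set p + u | u in [set u | u \in U]] /\ \dim U = D.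

Definition polytope_dim P : nat := xget 0%N [set D | is_dim P D].

(* A vertex is a 0-dimensional face: a point of P at which some linear
   functional attains its maximum over P, and nowhere else on P. *)
Definition vertex P v : Prop :=
  P v /\ exists c : 'rV[R]_d, forall x, P x -> x <> v ->
    \sum_i c 0 i * x 0 i < \sum_i c 0 i * v 0 i.

Definition dilate (q : nat) P : set 'rV[R]_d := [set q%:R *: x | x in P].

Definition lattice_dilation P (q : nat) : Prop :=
  (0 < q)%N /\ forall v, vertex (dilate q P) v -> integral_pt v.

Definition is_denominator P (q : nat) : Prop :=
  lattice_dilation P q /\ forall q', lattice_dilation P q' -> (q <= q')%N.

Definition denominator P : nat := xget 0%N [set q | is_denominator P q].

Definition cone P : set 'rV[R]_(d + 1) :=
  [set x | exists (c : R) (p : 'rV[R]_d),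
    [/\ 0 <= c, P p & x = c *: row_mx p (const_mx 1)]].

Definition last_coord (x : 'rV[R]_(d + 1)) : R := x 0 (rshift d ord0).

Definition weval (w : weight R d) (x : 'rV[R]_(d + 1)) : R :=
  w.@[fun i => x 0 i].

Definition homogeneous (m : nat) (w : weight R d) : Prop := w \is m.-homog.

(* A sum (over s) of products (over each l in s) of linear forms; the empty
   sum is 0 and the empty product is 1. *)
Definition S_semiring P (w : weight R d) : Prop :=
  exists s : seq (seq (weight R d)),
    [/\ forall l, l \in s -> forall f, f \in l -> homogeneous 1 f,
        forall l, l \in s ->
          forall x, cone P x -> 0 <= weval (\prod_(f <- l) f) x
      & w = \sum_(l <- s) \prod_(f <- l) f].

(* The coefficient of t^n in Ehr(P, w; t).  For a polytope P the index set is
   finite, so the finitely supported sum is the ordinary sum. *)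
Definition Ehr_coef P (w : weight R d) (n : nat) : R :=
  \sum_(x \in [set x | [/\ cone P x, integral_pt x & last_coord x = n%:R]])
    weval w x.

(* The identity Ehr(P, w; t) * (1 - t^delta)^(dim P + m + 1) = h(t) between
   formal power series, coefficient by coefficient. *)
Definition is_hstar P (w : weight R d) (m : nat) (h : {poly R}) : Prop :=
  forall n : nat,
    \sum_(i < n.+1)
      ((1 - 'X^(denominator P)) ^+ (polytope_dim P + m + 1))`_i
        * Ehr_coef P w (n - i)
    = h`_n.

(* At most one polynomial satisfies is_hstar. *)
Definition hstar P (w : weight R d) (m : nat) : {poly R} :=
  xget 0 [set h | is_hstar P w m h].

End Polytopes.

(* 1 + t^e + t^(2e) + ... + t^(g - e), for e dividing g. *)
Definition geom_sum (R : realType) (e g : nat) (t : R) : R :=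
  \sum_(i < g %/ e) t ^+ (i * e).

(* Main.v *)
From HB Require Import structures.
From mathcomp Require Import all_boot all_order all_algebra.
From mathcomp Require Import finmap mpoly.
From mathcomp Require Import boolp classical_sets functions cardinality fsbigop.
From mathcomp Require Import reals.
From mathcomp Require Import ring lra zify.
Require Import Defs.

(* On 0 <= t < 1 the inequality compares the convergent series Ehr(P,w;t) and
   Ehr(Q,w;t) termwise, since w >= 0 on C(Q).  For t > 1 one substitutes 1/t and
   uses reciprocity: up to the power of (1 - t^delta), h*(t) is the series over
   the lattice points of the relative interior of the cone, and equality of
   dimensions gives relint C(P) inside relint C(Q).  The case t = 1 follows by
   continuity.

   Reciprocity and the existence of h* are one statement.  Let k = dim P + 1 and
   let A(n) be the sum, over lattice points x of height n, of w(x) times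
   1_C(x) - (-1)^k 1_{-relint C}(x); then (1 - T)^(k+m) A = 0, where
   (T A)(n) = A(n - delta).  The two summands are supported on n >= 0 and n < 0,
   so (1 - T)^(k+m) maps each of them to a finitely supported function.  A
   regular triangulation, made half-open by a generic perturbation, reduces
   this to simplicial cones, where it follows by induction: differencing along
   a generator either turns a ray into a unit interval or lowers the degree
   of w. *)

Set Implicit Arguments.
Unset Strict Implicit.
Unset Printing Implicit Defensive.

Import Order.TTheory GRing.Theory Num.Theory.

Local Open Scope classical_set_scope.
Local Open Scope ring_scope.

(** Every generator of C(P) is delta(P) times a lifted vertex, so all of them are integral of the
    same height delta(P) and a single operator 1 - T serves every simplicial cone; primitive
    generators could have different heights. Differences of a homogeneous weight are not
    homogeneous, so the induction runs over functions whose (m+1)-fold differences vanish, and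
    homogeneity returns only at the end, through the parity w(-x) = (-1)^m w(x). A half-open cone
    and the reflection of its counterpart must be treated together: the products of the indicators
    ray_i and of ray_i - 1 turn into the same product once every coordinate has been differenced, so
    their difference dies although neither does alone. Relative interiors are expressed by an
    interior vector q: x belongs to one if x - ep q stays in the cone for some ep > 0. This leaves
    finitely many linear inequalities and no topology. *)

Section Sequences.
Variable R : realType.
Implicit Types (f : int -> R) (e r : nat) (t : R).

(** * Backward differences and formal power series *)

Definition bdiff e f : int -> R := fun n => f n - f (n - e%:Z).

Lemma iter_bdiffB e r f1 f2 n :
  iter r (bdiff e) (fun n => f1 n - f2 n) n
  = iter r (bdiff e) f1 n - iter r (bdiff e) f2 n.
Proof. by elim: r n => //= r IH n; rewrite /bdiff !IH; ring. Qed.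

Lemma iter_bdiffZ e r c f n :
  iter r (bdiff e) (fun n => c * f n) n = c * iter r (bdiff e) f n.
Proof. by elim: r n => //= r IH n; rewrite /bdiff !IH; ring. Qed.

(** Reflection turns T into its inverse, and 1 - T^-1 = - T^-1 (1 - T); the [r] factors T^-1 produce
    the offset [e * r], which becomes the degree bound of h*. *)
Lemma iter_bdiff_rev e r f n :
  iter r (bdiff e) (fun n => f (- n)) n
  = (-1) ^+ r * iter r (bdiff e) f ((e * r)%:Z - n).
Proof.
elim: r n => [|r IH] n /=; first by rewrite mul1r muln0 sub0r.
rewrite /bdiff !IH exprS.
have -> : (e * r)%:Z - (n - e%:Z) = (e * r.+1)%:Z - n by lia.
have -> : (e * r.+1)%:Z - n - e%:Z = (e * r)%:Z - n by lia.
ring.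
Qed.

Lemma iter_bdiff_neg e r f : (forall n, n < 0 -> f n = 0) ->
  forall n, n < 0 -> iter r (bdiff e) f n = 0.
Proof.
move=> f0; elim: r => [|r IH] n n0 //=; first exact: f0.
by rewrite /bdiff !IH ?subrr //; lia.
Qed.

(** The action of p(T), where T is the shift by one. *)
Definition poly_act (p : {poly R}) f : int -> R :=
  fun n => \sum_(i < size p) p`_i * f (n - i%:Z).

Lemma poly_act_wide (p : {poly R}) f n N : (size p <= N)%N ->
  poly_act p f n = \sum_(i < N) p`_i * f (n - i%:Z).
Proof.
move=> pN; rewrite -(subnKC pN) big_split_ord /= [X in _ + X]big1 ?addr0 //.
by move=> i _; rewrite nth_default ?mul0r ?leq_addr.
Qed.

Lemma poly_act_bdiff e (p : {poly R}) f n :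
  poly_act ((1 - 'X^e) * p) f n = bdiff e (poly_act p f) n.
Proof.
pose N := (e + size p)%N.
have sN : (size ((1 - 'X^e) * p)%R <= N)%N.
  rewrite mulrBl mul1r (leq_trans (size_polyD _ _)) // size_polyN geq_max leq_addl /=.
  rewrite mulrC; have [->|p0] := eqVneq p 0; first by rewrite mul0r size_poly0 leq0n.
  by rewrite size_Mmonic ?monicXn // size_polyXn addnS /= addnC leqnn.
rewrite (poly_act_wide _ _ sN) /bdiff (poly_act_wide _ _ (leq_addl e (size p))).
under eq_bigr do rewrite mulrBl mul1r coefB mulrBl.
rewrite sumrB; congr (_ - _).
rewrite big_split_ord /= big1 ?add0r => [|i _]; last first.
  by rewrite coefXnM ltn_ord mul0r.
apply: eq_bigr => i _; rewrite coefXnM ltnNge leq_addr /= addKn.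
by congr (_ * f _); lia.
Qed.

Lemma poly_act_iter e r f n :
  poly_act ((1 - 'X^e) ^+ r) f n = iter r (bdiff e) f n.
Proof.
elim: r n => [|r IH] n.
  by rewrite expr0 (poly_act_wide _ _ (N := 1)) ?size_poly1 // big_ord1 coef1 mul1r subr0.
by rewrite exprS poly_act_bdiff /bdiff !IH.
Qed.

(** Since [f] vanishes at negative arguments, the two-sided action of (1 - T^e)^r is the truncated
    Cauchy product that defines h*. *)
Lemma iter_bdiff_convolution e r (a : nat -> R) f n :
  (forall n, n < 0 -> f n = 0) -> (forall n : nat, f n = a n) ->
  \sum_(i < n.+1) ((1 - 'X^e) ^+ r)`_i * a (n - i)%N
  = iter r (bdiff e) f n.
Proof.
move=> f0 fa; set p := (_ ^+ r).
rewrite -poly_act_iter -/p (poly_act_wide _ _ (leq_addl n.+1 (size p))).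
rewrite big_split_ord /= [X in _ + X]big1 ?addr0 => [|i _]; last first.
  by rewrite f0 ?mulr0 //; lia.
apply: eq_bigr => i _; rewrite -fa; congr (_ * f _).
by have := ltn_ord i; lia.
Qed.

(** * Values of power series on 0 <= t < 1, and passage to t = 1 *)

Definition tends (s : nat -> R) (l : R) :=
  forall eps, 0 < eps -> exists N : nat, forall n, (N <= n)%N -> `|s n - l| < eps.

Lemma tends_le s1 s2 l1 l2 : (forall n, s1 n <= s2 n) ->
  tends s1 l1 -> tends s2 l2 -> l1 <= l2.
Proof.
move=> s12 t1 t2; rewrite leNgt; apply/negP => l21.
have e0 : 0 < (l1 - l2) / 2 by lra.
have [N1 h1] := t1 _ e0; have [N2 h2] := t2 _ e0.
have := h1 (maxn N1 N2) (leq_maxl _ _); have := h2 (maxn N1 N2) (leq_maxr _ _).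
by rewrite !ltr_distl => /andP[_ ?] /andP[? _]; have := s12 (maxn N1 N2); lra.
Qed.

Lemma expr_small (a M eps : R) : 0 <= a -> a < 1 -> 0 < eps ->
  exists N : nat, forall n, (N <= n)%N -> a ^+ n * M < eps.
Proof.
move=> a0 a1 e0.
(* A Bernoulli-type bound: powers of [a] decay at least like 1/n, which is enough here. *)
have B n : a ^+ n * (1 + n%:R * (1 - a)) <= 1.
  elim: n => [|n IH]; first by rewrite expr0 !mul1r; lra.
  apply: le_trans IH; rewrite exprSr -mulrA ler_wpM2l ?exprn_ge0 //.
  have n0 : 0 <= n%:R :> R by rewrite ler0n.
  have : 0 <= (n%:R + 1) * (1 - a) ^+ 2 :> R by rewrite mulr_ge0 ?sqr_ge0 ?addr_ge0.
  by rewrite -natr1 expr2; lra.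
have K0 : 0 <= `|M| / (eps * (1 - a)).
  by rewrite divr_ge0 ?mulr_ge0 ?normr_ge0 //; lra.
exists (Num.Def.archi_bound (`|M| / (eps * (1 - a)))) => n Nn.
have := archi_boundP K0; rewrite ltr_pdivrMr; last by apply: mulr_gt0; lra.
move=> MN; have {MN}MN : `|M| < n%:R * (eps * (1 - a)).
  apply: lt_le_trans MN _; rewrite ler_pM2r ?ler_nat //.
  by apply: mulr_gt0; lra.
apply: (@le_lt_trans _ _ (a ^+ n * `|M|)).
  by rewrite ler_wpM2l ?exprn_ge0 ?ler_norm.
have an0 : 0 <= a ^+ n by rewrite exprn_ge0.
have [an|an] := eqVneq (a ^+ n) 0; first by rewrite an mul0r.
have {an0} an : 0 < a ^+ n by rewrite lt_def an.
apply: (@lt_le_trans _ _ (a ^+ n * (n%:R * (eps * (1 - a))))).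
  by rewrite ltr_pM2l.
have := B n; nra.
Qed.

(** Along each residue class modulo [e] the recursion is a contraction with factor [a]. An error of
    at most eps (1 - a) / 2 per step accumulates to at most eps / 2, the fixed point, and the
    initial values are damped by the powers of [a]. *)
Lemma tends0_recursive (u v : nat -> R) e (a : R) :
  0 <= a -> a < 1 -> (0 < e)%N -> tends v 0 ->
  (forall n, u (n + e)%N = v (n + e)%N + a * u n) -> tends u 0.
Proof.
move=> a0 a1 e0 v0 uv eps eps0.
have [N0 hN0] := v0 (eps * (1 - a) / 2) ltac:(nra).
pose M := \sum_(i < e) `|u (N0 + i)%N|.
have M0 : 0 <= M by apply: sumr_ge0 => i _; exact: normr_ge0.
have bd j i : (i < e)%N -> `|u (N0 + (j * e + i))%N| <= eps / 2 + a ^+ j * M.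
  move=> ie; elim: j => [|j IH].
    rewrite mul0n add0n expr0 mul1r /M (bigD1 (Ordinal ie)) //=.
    have : 0 <= \sum_(i0 < e | i0 != Ordinal ie) `|u (N0 + i0)%N|.
      by apply: sumr_ge0 => k _; exact: normr_ge0.
    by lra.
  have -> : (N0 + (j.+1 * e + i) = (N0 + (j * e + i)) + e)%N by lia.
  rewrite uv (le_trans (ler_normD _ _)) // normrM (ger0_norm a0).
  have := hN0 (N0 + (j * e + i) + e)%N ltac:(lia); rewrite subr0 => vb.
  by rewrite exprS; nra.
have [J hJ] := expr_small M a0 a1 (eps := eps / 2) ltac:(lra).
exists (N0 + J * e)%N => n nN; rewrite subr0.
have := bd ((n - N0) %/ e)%N ((n - N0) %% e)%N (ltn_pmod _ e0).
rewrite -divn_eq subnKC; last by lia.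
have : (J <= (n - N0) %/ e)%N by rewrite leq_divRL //; lia.
by move/hJ; lra.
Qed.

Definition psum f t (N : nat) : R := \sum_(i < N) f i%:Z * t ^+ i.

Lemma psum_bdiff e f t N : (forall n, n < 0 -> f n = 0) ->
  psum (bdiff e f) t (N + e)%N = psum f t (N + e)%N - t ^+ e * psum f t N.
Proof.
move=> f0; rewrite /psum; under eq_bigr do rewrite mulrBl.
rewrite sumrB; congr (_ - _); rewrite addnC big_split_ord /= big1 ?add0r.
  rewrite mulr_sumr; apply: eq_bigr => i _; rewrite exprD mulrCA; congr (_ * (f _ * _)).
  by lia.
by move=> i _; rewrite f0 ?mul0r //; have := ltn_ord i; lia.
Qed.

(** One factor 1 - t^e is divided out. Convergence of the series of [f] is a conclusion: its partial
    sums satisfy the contracting recursion, driven by those of [bdiff e f]. *)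
Lemma psum_bdiff_lim e f t l : (forall n, n < 0 -> f n = 0) ->
  (0 < e)%N -> 0 <= t -> t < 1 ->
  tends (psum (bdiff e f) t) l -> tends (psum f t) (l / (1 - t ^+ e)).
Proof.
move=> f0 e0 t0 t1 lim.
have te : t ^+ e < 1 by rewrite exprn_ilt1 // -lt0n.
have te0 : 0 <= t ^+ e by rewrite exprn_ge0.
set L := l / _.
have LE : L * (1 - t ^+ e) = l by rewrite mulfVK //; lra.
have : tends (fun n => psum f t n - L) 0.
  apply: (@tends0_recursive _ (fun n => psum (bdiff e f) t n - l) e (t ^+ e)) => //.
    by move=> eps /lim[N hN]; exists N => n /hN; rewrite subr0.
  by move=> n; rewrite psum_bdiff //; rewrite -LE; ring.
by move=> h eps /h[N hN]; exists N => n /hN; rewrite subr0.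
Qed.

Lemma psum_lim e r f t (h : {poly R}) : (forall n, n < 0 -> f n = 0) ->
  (0 < e)%N -> 0 <= t -> t < 1 ->
  (forall n : nat, iter r (bdiff e) f n = h`_n) ->
  tends (psum f t) (h.[t] / (1 - t ^+ e) ^+ r).
Proof.
move=> f0 e0 t0 t1 fh.
suff H j : (j <= r)%N ->
    tends (psum (iter (r - j) (bdiff e) f) t) (h.[t] / (1 - t ^+ e) ^+ j).
  by have := H r (leqnn r); rewrite subnn.
elim: j => [_|j IH jr].
  rewrite subn0 expr0 divr1 => eps eps0; exists (size h) => n hn.
  rewrite (horner_coef_wide _ hn) /psum; under eq_bigr do rewrite fh.
  by rewrite subrr normr0.
rewrite exprSr invfM mulrA; apply: psum_bdiff_lim => //.
  exact: iter_bdiff_neg.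
by rewrite -iterS subnSK //; apply: IH; exact: ltnW.
Qed.

(** On [0,1] the polynomial satisfies p(s) - p(1) <= K (1 - s), so a negative value at 1 would
    persist at a point [s] < 1 close to 1. *)
Lemma horner_ge0_at1 (p : {poly R}) :
  (forall t, 0 <= t -> t < 1 -> 0 <= p.[t]) -> 0 <= p.[1].
Proof.
move=> p0; rewrite leNgt; apply/negP => p1.
pose K := \sum_(i < size p) `|p`_i| * i%:R.
have K0 : 0 <= K by apply: sumr_ge0 => i _; rewrite mulr_ge0 ?ler0n.
have X n (t : R) : 0 <= t -> t <= 1 -> 0 <= 1 - t ^+ n <= n%:R * (1 - t).
  move=> t0 t1; elim: n => [|n /andP[l1 l2]]; first by rewrite expr0 mul0r subrr lexx.
  have := exprn_ge0 n t0; rewrite exprS -natr1 => tn0; apply/andP; split; nra.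
pose s := 1 - Num.min 1 (- p.[1] / (K + 1)).
have m0 : 0 < Num.min 1 (- p.[1] / (K + 1)).
  by rewrite lt_min ltr01 /= divr_gt0 //; lra.
have m1 : Num.min 1 (- p.[1] / (K + 1)) <= 1 by rewrite ge_min lexx.
have m2 : Num.min 1 (- p.[1] / (K + 1)) * (K + 1) <= - p.[1].
  by rewrite -ler_pdivlMr ?ge_min ?lexx ?orbT //; lra.
have s0 : 0 <= s by rewrite /s; lra.
have s1 : s < 1 by rewrite /s; lra.
have := p0 s s0 s1.
have : p.[s] - p.[1] <= K * (1 - s).
  rewrite !horner_coef -sumrB mulr_suml ler_sum // => i _.
  rewrite expr1n mulr1 -{2}[p`_i]mulr1 -mulrBr -mulrA.
  have /andP[l1 l2] := X i s s0 (ltW s1).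
  apply: le_trans (ler_norm _) _; rewrite normrM ler_wpM2l //.
  by rewrite -opprB normrN ger0_norm.
by rewrite {2}/s; nra.
Qed.

End Sequences.

(** * Functions on a lattice with vanishing iterated differences *)

Section FiniteDifferences.
Variables (R : realType) (X : zmodType).
Implicit Types f g : X -> R.

(* [deg_lt m f]: all m-fold finite differences of f vanish, so that f behaves
   like a polynomial of degree < m. *)
Fixpoint deg_lt m f : Prop :=
  if m is m'.+1 then forall u, deg_lt m' (fun x => f (x + u) - f x)
  else forall x, f x = 0.

Lemma deg_lt0 m : deg_lt m (fun=> 0).
Proof. by elim: m => [|m IH] //= u; rewrite subrr. Qed.

Lemma deg_ltD m f g : deg_lt m f -> deg_lt m g -> deg_lt m (fun x => f x + g x).
Proof.
elim: m f g => [|m IH] f g /= fm gm; first by move=> x; rewrite fm gm addr0.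
move=> u; have := IH _ _ (fm u) (gm u); congr deg_lt.
by apply/funext => x; ring.
Qed.

Lemma deg_lt_shift m f v : deg_lt m f -> deg_lt m (fun x => f (x + v)).
Proof.
elim: m f => [|m IH] f /= fm; first by move=> x; rewrite fm.
move=> u; have := IH _ (fm u); congr deg_lt.
by apply/funext => x; rewrite addrAC.
Qed.

(** Discrete Leibniz rule, by induction on the total degree: each summand of the difference of a
    product has one factor of lower degree. *)
Lemma deg_ltM a b f g : deg_lt a.+1 f -> deg_lt b.+1 g ->
  deg_lt (a + b).+1 (fun x => f x * g x).
Proof.
move: {2}(a + b)%N (leqnn (a + b)) => N; elim: N a b f g => [|N IH] a b f g.
  rewrite leqn0 addn_eq0 => /andP[/eqP-> /eqP->] /= fm gm u x.
  by rewrite (subr0_eq (fm u x)) (subr0_eq (gm u x)) subrr.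
move=> abN fm gm u.
rewrite -/(deg_lt (a + b) _).
have -> : (fun x => f (x + u) * g (x + u) - f x * g x)
        = (fun x => (f (x + u) - f x) * g (x + u) + f x * (g (x + u) - g x)).
  by apply/funext => x; ring.
apply: deg_ltD.
  case: a abN fm => [|a] abN fm.
    have -> : (fun x => (f (x + u) - f x) * g (x + u)) = fun=> 0.
      by apply/funext => x; rewrite (fm u x) mul0r.
    exact: deg_lt0.
  apply: IH; [lia | exact: fm | exact: deg_lt_shift].
case: b abN gm => [|b] abN gm.
  have -> : (fun x => f x * (g (x + u) - g x)) = fun=> 0.
    by apply/funext => x; rewrite (gm u x) mulr0.
  exact: deg_lt0.
rewrite addnS; apply: IH; [lia | exact: fm | exact: gm].
Qed.

Lemma deg_lt_cst c : deg_lt 1 (fun=> c).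
Proof. by move=> u x; rewrite subrr. Qed.

Lemma deg_ltX a n f : deg_lt a.+1 f -> deg_lt (a * n).+1 (fun x => f x ^+ n).
Proof.
move=> fa; elim: n => [|n IH]; first by rewrite muln0; exact: deg_lt_cst.
have -> : (fun x => f x ^+ n.+1) = (fun x => f x * f x ^+ n).
  by apply/funext => x; rewrite exprS.
by rewrite mulnS; apply: deg_ltM.
Qed.

End FiniteDifferences.

(** * Sums over the lattice points of a given height *)

Section HeightSums.
Variables (R : realType) (X : zmodType) (ht : {additive X -> int}).
Implicit Types F G : X -> R.

Definition hsum F (n : int) : R := \sum_(x \in [set x | ht x = n]) F x.

(** A finitely supported sum defaults to 0 on infinite support, so additivity of [hsum] needs this
    condition. *)
Definition hfin F := forall n, finite_set [set x | ht x = n /\ F x <> 0].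

Lemma hfin_sub F G : (forall x, F x <> 0 -> G x <> 0) -> hfin G -> hfin F.
Proof. by move=> FG fG n; apply: sub_finite_set (fG n) => x /= [-> /FG]. Qed.

Lemma hfinD F G : hfin F -> hfin G -> hfin (fun x => F x + G x).
Proof.
move=> fF fG n.
apply: (@sub_finite_set _ _ ([set x | ht x = n /\ F x <> 0]
                              `|` [set x | ht x = n /\ G x <> 0])).
  move=> x /= [hx FG]; have [F0|/eqP F0] := eqVneq (F x) 0; last by left.
  by right; split=> // G0; apply: FG; rewrite F0 G0 addr0.
by rewrite finite_setU.
Qed.

Lemma hfinMl F f : hfin F -> hfin (fun x => f x * F x).
Proof. by apply: hfin_sub => x fF F0; apply: fF; rewrite F0 mulr0. Qed.

Lemma hfin_shift F u : hfin F -> hfin (fun x => F (x - u)).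
Proof.
move=> fF n.
have := finite_image (fun x => x + u) (fF (n - ht u)); apply: sub_finite_set.
move=> x /= [hx Fx]; exists (x - u); last by rewrite subrK.
by rewrite raddfB hx.
Qed.

Lemma hsumD F G n : hfin F -> hfin G ->
  hsum (fun x => F x + G x) n = hsum F n + hsum G n.
Proof.
move=> fF fG; rewrite /hsum.
pose P := [set x | ht x = n /\ F x <> 0] `|` [set x | ht x = n /\ G x <> 0].
have finP : finite_set P by rewrite finite_setU.
have sub : P `<=` [set x | ht x = n] by move=> x [] [].
have W H : (forall x, ht x = n -> H x <> 0 -> P x) ->
    \sum_(x \in [set x | ht x = n]) H x = \sum_(x \in P) H x :> R.
  move=> HP; symmetry; apply: fsbig_widen => // x /= [hx nPx].
  by apply: contrapT => Hx; apply: nPx; apply: HP.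
rewrite !W; first exact: fsbig_split.
- by move=> x hx Hx; right.
- by move=> x hx Hx; left.
- move=> x hx Hx; have [F0|/eqP F0] := eqVneq (F x) 0; last by left.
  by right; split=> // G0; apply: Hx; rewrite F0 G0 addr0.
Qed.

Lemma hsumZ F c n : hfin F -> hsum (fun x => c * F x) n = c * hsum F n.
Proof.
move=> fF; rewrite /hsum full_fsbig_distrr //.
by apply: sub_finite_set (fF n) => x /=.
Qed.

Lemma hsum0 F n : (forall x, F x = 0) -> hsum F n = 0.
Proof. by move=> F0; apply: fsbig1. Qed.

Lemma eq_hsum F G n : (forall x, ht x = n -> F x = G x) -> hsum F n = hsum G n.
Proof. by move=> FG; apply: eq_fsbigr => x; rewrite inE => /FG. Qed.

Lemma hsum_shift F u n : hsum (fun x => F (x - u)) n = hsum F (n - ht u).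
Proof.
rewrite /hsum; symmetry.
apply: (@reindex_fsbig _ _ _ _ _ (fun x => x - u)); split.
- by move=> x /= <-; rewrite raddfB.
- by move=> x y _ _ /addIr.
- move=> y /= hy; exists (y + u); last by rewrite addrK.
  by rewrite raddfD hy subrK.
Qed.

Lemma hsum_sum (I : Type) (r : seq I) (P : pred I) (F : I -> X -> R) n :
  (forall i, P i -> hfin (F i)) ->
  hfin (fun x => \sum_(i <- r | P i) F i x) /\
  hsum (fun x => \sum_(i <- r | P i) F i x) n = \sum_(i <- r | P i) hsum (F i) n.
Proof.
move=> fF; elim: r => [|i r [IH1 IH2]].
  have -> : (fun x => \sum_(i <- [::] | P i) F i x) = fun=> 0.
    by apply/funext => x; rewrite big_nil.
  rewrite big_nil hsum0 //; split=> // k; have -> : [set x | ht x = k /\ (0 : R) <> 0] = set0.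
    by rewrite -subset0 => x [].
  exact: finite_set0.
have -> : (fun x => \sum_(i <- i :: r | P i) F i x)
        = (fun x => if P i then F i x + \sum_(i <- r | P i) F i x
                    else \sum_(i <- r | P i) F i x).
  by apply/funext => x; rewrite big_cons.
rewrite big_cons; case: ifP => Pi; last by [].
by split; [apply: hfinD => //; apply: fF | rewrite hsumD ?IH2 //; apply: fF].
Qed.

End HeightSums.

(* X is a lattice, V a sublattice predicate, mu i independent vectors of
   height e and al i the coordinates with respect to them; ray i is one of the
   half-lines [0,oo) and (0,oo). *)
Section SimplicialCone.
Variables (R : realType) (X : zmodType) (ht : {additive X -> int}).
Variables (I : finType) (al : I -> X -> R) (mu : I -> X) (V : X -> bool).
Variables (ray : I -> R -> bool) (e : nat).
Hypothesis e_gt0 : (0 < e)%N.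
Hypothesis alB : forall i j x, al i (x - mu j) = al i x - (i == j)%:R.
Hypothesis VB : forall j x, V (x - mu j) = V x.
Hypothesis ht_mu : forall j, ht (mu j) = e%:Z.
Hypothesis ht_al : forall x, V x -> (ht x)%:~R = e%:R * \sum_i al i x.
Hypothesis V_fin : forall M : R,
  finite_set [set x | V x /\ forall i, `|al i x| <= M].
Hypothesis ray_pos : forall i a, 0 < a -> ray i a.
Hypothesis ray_neg : forall i a, a < 0 -> ~~ ray i a.

Let rayr i x : R := (ray i (al i x))%:R.
Let box i x : R := rayr i x - rayr i (x - mu i).

(** [S] records the generators along which a difference has been taken: there the ray has become a
    half-open unit interval and [c] has left no trace. *)
Let prod_of (c : R) (S : {set I}) x :=
  \prod_i (if i \in S then box i x else rayr i x - c).

Let gS (S : {set I}) x : R := (V x)%:R * (prod_of 0 S x - prod_of 1 S x).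

Let rayr_mu i j x : i != j -> rayr i (x - mu j) = rayr i x.
Proof. by move=> ij; rewrite /rayr alB (negbTE ij) subr0. Qed.

Let prod_of_mu c (S : {set I}) j x :
  \prod_(i | i != j) (if i \in S then box i (x - mu j) else rayr i (x - mu j) - c)
  = \prod_(i | i != j) (if i \in S then box i x else rayr i x - c).
Proof.
apply: eq_bigr => i ij; rewrite /box rayr_mu //.
by rewrite -addrA -opprD [mu j + _]addrC opprD addrA rayr_mu.
Qed.

Let prod_ofU c (S : {set I}) j x :
  \prod_(i | i != j) (if i \in j |: S then box i x else rayr i x - c)
  = \prod_(i | i != j) (if i \in S then box i x else rayr i x - c).
Proof. by apply: eq_bigr => i ij; rewrite !inE (negbTE ij). Qed.

Let gS_step (S : {set I}) j x : j \notin S -> gS S x - gS S (x - mu j) = gS (j |: S) x.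
Proof.
move=> jS; rewrite /gS /prod_of VB.
rewrite !(bigD1 (P := xpredT) j) //= !prod_of_mu !prod_ofU !(negbTE jS) finset.setU11 /box.
by ring.
Qed.

(** If the product for [c] = 0 is nonzero, all coordinates are at least 0; if the one for [c] = 1 is
    nonzero, all are at most 1. The height fixes the sum of the coordinates, so in both cases each
    of them is bounded. *)
Let gS_fin (S : {set I}) : hfin ht (gS S).
Proof.
move=> n; pose M : R := `|n%:~R| / e%:R + #|I|%:R + 1.
apply: sub_finite_set (V_fin M) => x /= [hx gx].
have Vx : V x by apply: contrapT => /negP/negbTE Vx; apply: gx; rewrite /gS Vx mul0r.
split=> // k.
have e0 : 0 < e%:R :> R by rewrite ltr0n.
have sumE : \sum_i al i x = n%:~R / e%:R.
  by apply: (canRL (mulfK _)); rewrite ?gt_eqF // mulrC -ht_al // hx.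
have ne : `|n%:~R / e%:R| = `|n%:~R| / e%:R :> R.
  by rewrite normrM normfV (gtr0_norm e0).
have nle := ler_norm (n%:~R / e%:R : R); have nge := ler_norm (- (n%:~R / e%:R) : R).
rewrite normrN ne in nge; rewrite ne in nle.
have boxP i : box i x != 0 -> 0 <= al i x <= 1.
  rewrite /box /rayr alB eqxx mulr1n; apply: contraNT; rewrite negb_and -!ltNge.
  case/orP => h.
    by rewrite (negbTE (ray_neg i h)) (negbTE (ray_neg i (a := al i x - 1) _)) ?subrr //; lra.
  by rewrite !ray_pos ?subrr //; lra.
have cI : 1 <= #|I|%:R :> R by rewrite ler1n; apply/card_gt0P; exists k.
have [p0|p0] := eqVneq (prod_of 0 S x) 0.
  have /prodf_neq0 p1 : prod_of 1 S x != 0.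
    by apply: contra_not_neq gx => p1; rewrite /gS p0 p1 subrr mulr0.
  have le1 i : al i x <= 1.
    have := p1 i isT; case: ifP => _; first by move/boxP/andP => [].
    by apply: contraNT; rewrite -ltNge => h; rewrite /rayr ray_pos ?subrr //; lra.
  have : \sum_(i | i != k) al i x <= \sum_(i | i != k) 1 by apply: ler_sum => i _.
  rewrite sumr_const => h1.
  have h2 : #|[pred i | i != k]|%:R <= #|I|%:R :> R by rewrite ler_nat max_card.
  move: sumE; rewrite (bigD1 k) //= => sumE; rewrite ler_norml; apply/andP; split.
    by rewrite /M; lra.
  by have := le1 k; have := divr_ge0 (normr_ge0 (n%:~R : R)) (ltW e0); rewrite /M; lra.
have /prodf_neq0 {}p0 := p0.
have ge0 i : 0 <= al i x.
  have := p0 i isT; case: ifP => _; first by move/boxP/andP => [].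
  apply: contraNT; rewrite -ltNge => h.
  by rewrite /rayr (negbTE (ray_neg i h)) subrr.
have : 0 <= \sum_(i | i != k) al i x by apply: sumr_ge0.
move: sumE; rewrite (bigD1 k) //= => sumE h; rewrite ger0_norm // /M; lra.
Qed.

(** Product rule along [mu j]: since [mu j] has height [e], differencing the height sums is
    differencing the summand along [mu j]. *)
Let bdiff_gS (S : {set I}) j f n : j \notin S ->
  bdiff e (hsum ht (fun x => f x * gS S x)) n
  = hsum ht (fun x => f x * gS (j |: S) x) n
    + hsum ht (fun x => (f (x + mu j) - f x) * gS S x) (n - e%:Z).
Proof.
move=> jS; rewrite /bdiff -(ht_mu j) -!hsum_shift.
have f2 := hfin_shift (mu j) (hfinMl f (gS_fin S)).
have f3 := hfinMl f (gS_fin (j |: S)).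
have f4 := hfin_shift (mu j) (hfinMl (fun x => f (x + mu j) - f x) (gS_fin S)).
apply/eqP; rewrite subr_eq -!hsumD //; last exact: hfinD.
by apply/eqP; apply: eq_hsum => x _; rewrite -gS_step // subrK; ring.
Qed.

(** Induction on [#|~: S| + m]: the product rule enlarges [S] or lowers the degree of [f]. The sum
    vanishes outright as soon as [S] is full, because the two products then agree, or [m] = 0; hence
    one difference fewer than the total suffices. *)
Let kill_gS m f (S : {set I}) n : deg_lt m f ->
  iter (#|~: S| + m).-1 (bdiff e) (hsum ht (fun x => f x * gS S x)) n = 0.
Proof.
have it0 N k : iter N (bdiff e) (fun=> 0 : R) k = 0.
  by elim: N k => //= N IH k; rewrite /bdiff !IH subrr.
have itD N F G k : iter N (bdiff e) (fun n => F n + G (n - e%:Z)) k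
    = iter N (bdiff e) F k + iter N (bdiff e) G (k - e%:Z) :> R.
  by elim: N k => //= N IH k; rewrite /bdiff !IH; ring.
move: {2}(#|~: S| + m)%N (leqnn (#|~: S| + m)) => N.
elim: N m f S n => [|N IH] m f S n Nle fm.
  suff -> : hsum ht (fun x => f x * gS S x) = fun=> 0 by rewrite it0.
  apply/funext => k; apply: hsum0 => x.
  by case: m fm Nle => [|m] fm; [rewrite fm mul0r | lia].
have [S0|Sn0] := posnP #|~: S|.
  suff -> : hsum ht (fun x => f x * gS S x) = fun=> 0 by rewrite it0.
  apply/funext => k; apply: hsum0 => x; rewrite /gS /prod_of.
  have inS i : i \in S.
    by apply: contraT => iS; move: (card0_eq S0 i); rewrite !inE iS.
  by under eq_bigr do rewrite inS; under [X in _ - X]eq_bigr do rewrite inS;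
    rewrite subrr !mulr0.
case: m fm Nle => [|m] fm Nle.
  suff -> : hsum ht (fun x => f x * gS S x) = fun=> 0 by rewrite it0.
  by apply/funext => k; apply: hsum0 => x; rewrite fm mul0r.
have /card_gt0P[j] := Sn0; rewrite inE => jS.
have cj : #|~: S| = #|~: (j |: S)|.+1.
  by rewrite (cardsD1 j) inE jS add1n; congr (#|pred_of_set _|.+1);
     apply/setP => i; rewrite !inE negb_or.
rewrite cj addSn addnS /= -iterS iterSr.
have -> : bdiff e (hsum ht (fun x => f x * gS S x)) = fun n =>
    hsum ht (fun x => f x * gS (j |: S) x) n
    + hsum ht (fun x => (f (x + mu j) - f x) * gS S x) (n - e%:Z).
  by apply/funext => k; rewrite (bdiff_gS _ _ jS).
rewrite itD.
have := IH _ _ (j |: S) n _ fm; rewrite addnS /= => ->; last by lia.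
have := IH _ _ S (n - e%:Z) _ (fm (mu j)); rewrite cj addSn /= => ->; last by lia.
by rewrite addr0.
Qed.

(** The sign comes from ray - 1 = - (~~ ray) in each of the [#|I|] coordinates, so this is [gS] at
    the empty set. *)
Definition simplicial_pair x : R :=
  (V x && [forall i, ray i (al i x)])%:R
  - (-1) ^+ #|I| * (V x && [forall i, ~~ ray i (al i x)])%:R.

Let simplicial_pairE : simplicial_pair = gS finset.set0.
Proof.
apply/funext => x; rewrite /simplicial_pair /gS /prod_of.
case: (V x) => /=; last by rewrite mulr0 subrr mul0r.
rewrite mul1r; congr (_ - _).
  under eq_bigr do rewrite inE subr0.
  case: forallP => [h|/forallP/forallPn[i hi]].
    by rewrite big1 // => i _; rewrite /rayr h.
  by rewrite (bigD1 i) //= /rayr (negbTE hi) mul0r.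
under [RHS]eq_bigr do rewrite inE.
case: forallP => [h|/forallP/forallPn[i]].
  rewrite mulr1 -prodr_const; apply: eq_bigr => i _.
  by rewrite /rayr (negbTE (h i)) sub0r.
by rewrite negbK => hi; rewrite (bigD1 i) //= /rayr hi subrr mul0r mulr0.
Qed.

Lemma simplicial_fin : hfin ht simplicial_pair.
Proof. by rewrite simplicial_pairE. Qed.

Lemma simplicial_kill m (f : X -> R) n : deg_lt m.+1 f ->
  iter (#|I| + m) (bdiff e) (hsum ht (fun x => f x * simplicial_pair x)) n = 0.
Proof.
move=> /(@kill_gS _ _ finset.set0 n).
by rewrite finset.setC0 cardsT addnS /= simplicial_pairE.
Qed.

End SimplicialCone.

(** * Small and generic parameters *)

Section Generic.
Variable R : realType.

Lemma small_all (A : finType) (P : A -> R -> Prop) :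
  (forall k, exists2 e, 0 < e & forall e', 0 < e' -> e' <= e -> P k e') ->
  exists2 e, 0 < e & forall k e', 0 < e' -> e' <= e -> P k e'.
Proof.
move=> hP; suff [e e0 h] : exists2 e, 0 < e &
    forall k, k \in enum A -> forall e', 0 < e' -> e' <= e -> P k e'.
  by exists e => // k; apply: h; rewrite mem_enum.
elim: (enum A) => [|a s [e e0 IH]]; first by exists 1.
have [e1 e10 h1] := hP a.
exists (Num.min e e1); first by rewrite lt_min e0.
move=> k; rewrite inE => /orP[/eqP->|ks] e' e'0; rewrite le_min => /andP[le1 le2].
  exact: h1.
exact: IH.
Qed.

(** The moment curve (1, s, s^2, ...) meets finitely many hyperplanes in finitely many points: on it
    the linear forms [w a] become nonzero polynomials in s. *)
Lemma generic_power (N : nat) (A : finType) (P : pred A) (w : A -> 'rV[R]_N) :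
  (forall a, P a -> w a != 0) ->
  exists2 s : R, 0 < s & forall a, P a -> \sum_i w a 0 i * s ^+ i != 0.
Proof.
move=> w0; pose pw a := \sum_(i < N) (w a 0 i)%:P * 'X^i : {poly R}.
have pwE a s : (pw a).[s] = \sum_i w a 0 i * s ^+ i.
  by rewrite horner_sum; apply: eq_bigr => i _; rewrite !hornerE.
have pw0 a : P a -> pw a != 0.
  move=> /w0; apply: contraNneq => pa; apply/eqP/rowP => i; rewrite mxE.
  have := congr1 (fun p : {poly R} => p`_i) pa; rewrite coef0 coef_sum (bigD1 i) //=.
  rewrite coefCM coefXn eqxx mulr1 big1 ?addr0 // => j ji.
  by rewrite coefCM coefXn eq_sym -val_eqE in ji *; rewrite (negbTE ji) mulr0.
pose p := \prod_(a | P a) pw a.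
have p0 : p != 0 by apply/prodf_neq0.
(* More positive candidates than a nonzero polynomial of this size has roots. *)
pose rs := [seq (k.+1)%:R : R | k <- iota 0 (size p)].
have : ~~ all (root p) rs.
  have urs : uniq rs.
    by rewrite map_inj_uniq ?iota_uniq // => i j /eqP; rewrite eqr_nat => /eqP[].
  apply/negP => ra; have := max_poly_roots p0 ra urs.
  by rewrite size_map size_iota ltnn.
case/allPn => s /mapP[k _ ->] nr; exists k.+1%:R; first by rewrite ltr0n.
move=> a Pa; rewrite -pwE; apply: contraNneq nr => pa.
by rewrite /root /p horner_prod (bigD1 a) //= pa mul0r.
Qed.

End Generic.

(** * Regular triangulations of a cone, in the language of linear programming *)

Section Triangulation.
Variables (R : realType) (N n : nat) (U : 'M[R]_(N, n)).
Variables (eta : 'cV[R]_n) (e : R).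
Hypothesis e_gt0 : 0 < e.
Hypothesis U_eta : U *m eta = const_mx e.
Implicit Types (B : {set 'I_N}) (v : 'rV[R]_N) (x : 'rV[R]_n).

Definition rows_of B : 'M[R]_(#|B|, n) := rowsub (@enum_val _ (mem B)) U.

Definition isbasis B := row_free (rows_of B) && (U <= rows_of B)%MS.

(** Coordinates are extended by zero to all [N] generators, so that those for different bases can be
    compared, added and priced by one [cost]. *)
Definition crd B x : 'rV[R]_N :=
  x *m pinvmx (rows_of B) *m rowsub (@enum_val _ (mem B)) 1%:M.

Definition supported B v := forall i, i \notin B -> v 0 i = 0.

Definition in_cone x := exists2 v : 'rV[R]_N, (forall i, 0 <= v 0 i) & x = v *m U.

Lemma mul_sel B (y : 'rV[R]_#|B|) (k : 'I_#|B|) :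
  (y *m rowsub (@enum_val _ (mem B)) 1%:M) 0 (enum_val k) = y 0 k.
Proof.
rewrite mxE (bigD1 k) //= !mxE eqxx mulr1 big1 ?addr0 // => j jk.
by rewrite !mxE (inj_eq enum_val_inj) (negbTE jk) mulr0.
Qed.

Lemma crd_supported B x : supported B (crd B x).
Proof.
move=> i iB; rewrite mxE big1 // => j _; rewrite !mxE.
have [ij|] := eqVneq (enum_val j) i; last by rewrite mulr0.
by move: iB; rewrite -ij enum_valP.
Qed.

Lemma crdK B x : isbasis B -> (x <= U)%MS -> crd B x *m U = x.
Proof.
case/andP => _ UB xU; rewrite /crd -mulmxA mul_rowsub_mx mul1mx mulmxKpV //.
exact: submx_trans UB.
Qed.

Lemma supported_sel B v : supported B v ->
  v = (\row_k v 0 (enum_val k)) *m rowsub (@enum_val _ (mem B)) 1%:M.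
Proof.
move=> vB; apply/rowP => i; have [iB|iB] := boolP (i \in B).
  by rewrite -(enum_rankK_in iB iB) mul_sel mxE.
rewrite vB // mxE big1 // => j _; rewrite !mxE.
have [ij|] := eqVneq (enum_val j) i; last by rewrite mulr0.
by move: iB; rewrite -ij enum_valP.
Qed.

Lemma crd_mul B v : isbasis B -> supported B v -> crd B (v *m U) = v.
Proof.
case/andP => Bf _ vB; rewrite {2}(supported_sel vB) {1}(supported_sel vB).
by rewrite -mulmxA mul_rowsub_mx mul1mx /crd mulmxKp.
Qed.

Lemma card_basis B : isbasis B -> #|B| = \rank U.
Proof.
case/andP => Bf UB; rewrite -(eqP Bf); apply/eqP; rewrite eqn_leq.
rewrite (mxrankS UB) andbT; apply: mxrankS; exact: rowsub_sub.
Qed.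

Lemma crdD B x y : crd B (x + y) = crd B x + crd B y.
Proof. by rewrite /crd !mulmxDl. Qed.

Lemma crdZ B a x : crd B (a *: x) = a *: crd B x.
Proof. by rewrite /crd -!scalemxAl. Qed.

Lemma crd_row B i : isbasis B -> i \in B -> crd B (row i U) = delta_mx 0 i.
Proof.
move=> Bb iB; rewrite rowE crd_mul // => j jB; rewrite mxE eqxx /=.
by case: eqP => // ji; rewrite ji iB in jB.
Qed.

Definition freeset B := forall v, supported B v -> v *m U = 0 -> v = 0.

Lemma freeset_row_free B : freeset B -> row_free (rows_of B).
Proof.
move=> Bf; rewrite -kermx_eq0; apply/eqP/row_matrixP => i; rewrite row0.
set y := row i _; have yU : y *m rows_of B = 0 by rewrite -row_mul mulmx_ker row0.
move: y yU => y yU; pose v := y *m rowsub (@enum_val _ (mem B)) 1%:M.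
have v0 : v = 0.
  apply: Bf; last first.
    by rewrite /v -mulmxA mul_rowsub_mx mul1mx.
  move=> j jB; rewrite mxE big1 // => k _; rewrite !mxE.
  have [ij|] := eqVneq (enum_val k) j; last by rewrite mulr0.
  by move: jB; rewrite -ij enum_valP.
by apply/rowP => k; rewrite -mul_sel -/v v0 !mxE.
Qed.

Lemma freeset_basis B : freeset B -> exists2 B', isbasis B' & B \subset B'.
Proof.
move=> Bf.
have [B' /maxsetP[/asboolP B'f B'max] BB'] :=
  @maxset_exists _ (fun B => `[< freeset B >]) _ (asboolT Bf).
exists B' => //; apply/andP; split; first exact: freeset_row_free.
apply/row_subP => i; apply: contrapT => iB'.
have inB j : j \in B' -> (row j U <= rows_of B')%MS.
  move=> jB; have -> : row j U = row (enum_rank_in jB j) (rows_of B').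
    by apply/rowP => k; rewrite !mxE enum_rankK_in.
  exact: row_sub.
have niB : i \notin B' by apply/negP => /inB.
suff : i |: B' = B' by move=> E; move: niB; rewrite -E finset.setU11.
apply: B'max; last exact: finset.subsetU1.
apply/asboolP => v vs vU.
have vi : v 0 i = 0.
  apply: contrapT => /eqP vi; apply: iB'.
  have : v 0 i *: row i U = - \sum_(j | j != i) v 0 j *: row j U.
    by apply/eqP; rewrite -addr_eq0; move: vU; rewrite mulmx_sum_row (bigD1 i) //= => ->.
  move/(congr1 (fun y => (v 0 i)^-1 *: y)); rewrite scalerA mulVf // scale1r => ->.
  rewrite scalemx_sub // eqmx_opp summx_sub // => j ji.
  have [/inB h|jB] := boolP (j \in B'); first exact: scalemx_sub.
  by rewrite vs ?scale0r ?sub0mx // !inE negb_or ji.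
apply: B'f => // j jB; have [->//|ji] := eqVneq j i.
by apply: vs; rewrite !inE negb_or ji.
Qed.

Variable c : 'I_N -> R.

Definition cost v := \sum_i v 0 i * c i.

Lemma costD v1 v2 : cost (v1 + v2) = cost v1 + cost v2.
Proof. by rewrite -big_split; apply: eq_bigr => i _; rewrite mxE mulrDl. Qed.

Lemma costZ a v : cost (a *: v) = a * cost v.
Proof. by rewrite mulr_sumr; apply: eq_bigr => i _; rewrite mxE mulrA. Qed.

Lemma sum_ker v : v *m U = 0 -> \sum_i v 0 i = 0.
Proof.
move=> vU; have := congr1 (mulmx^~ eta) vU; rewrite mul0mx -mulmxA U_eta.
move/matrixP/(_ 0 0); rewrite !mxE; under eq_bigr do rewrite mxE.
by rewrite -mulr_suml => /eqP; rewrite mulf_eq0 (gt_eqF e_gt0) orbF => /eqP.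
Qed.

Lemma ker_pos v : v *m U = 0 -> v != 0 -> exists i, 0 < v 0 i.
Proof.
move=> vU; apply: contraNP => nex; apply/eqP/rowP => i; rewrite mxE.
have le0 j : v 0 j <= 0 by rewrite leNgt; apply/negP => vj; apply: nex; exists j.
have := sum_ker vU; rewrite (bigD1 i) //=.
have : \sum_(j | j != i) v 0 j <= 0 by apply: sumr_le0.
by have := le0 i; lra.
Qed.

(* Since heights force a kernel vector to have entries of both signs, one can
   always move along it without increasing the cost. *)
Lemma caratheodory v : (forall i, 0 <= v 0 i) ->
  exists B, [/\ isbasis B, forall i, 0 <= crd B (v *m U) 0 i
                & cost (crd B (v *m U)) <= cost v].
Proof.
pose S v := [set i | v 0 i != 0]%SET.
move: {2}(#|S v|) (leqnn #|S v|) => K; elim: K v => [|K IH] v vK v0.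
all: have [fr|nfr] := EM (freeset (S v)).
- have [B Bb SB] := freeset_basis fr; exists B.
  have vB : supported B v.
    by move=> i; apply: contraNeq => vi; apply: (fintype.subsetP SB); rewrite inE.
  by rewrite crd_mul.
- case: nfr => z zS _; apply/rowP => i; rewrite mxE zS //.
  by move: vK; rewrite leqn0 cards_eq0 => /eqP->; rewrite inE.
- have [B Bb SB] := freeset_basis fr; exists B.
  have vB : supported B v.
    by move=> i; apply: contraNeq => vi; apply: (fintype.subsetP SB); rewrite inE.
  by rewrite crd_mul.
have [z [zS zU z0 cz]] : exists z, [/\ supported (S v) z, z *m U = 0, z != 0 & 0 <= cost z].
  have [z] : exists z, [/\ supported (S v) z, z *m U = 0 & z != 0].
    apply: contrapT => h; apply: nfr => z zS zU; apply: contrapT => /eqP z0.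
    by apply: h; exists z.
  case=> zS zU z0; have [cz|/ltW cz] := leP 0 (cost z); first by exists z.
  exists (-1 *: z); split.
  - by move=> i /zS zi; rewrite mxE zi mulr0.
  - by rewrite -scalemxAl zU scaler0.
  - by rewrite scaler_eq0 oppr_eq0 oner_eq0.
  - by rewrite costZ; lra.
have [k0 zk0] := ker_pos zU z0.
have [k zk kmin] :=
  @Order.TotalTheory.arg_minP _ R _ k0 (fun i => 0 < z 0 i) (fun i => v 0 i / z 0 i) zk0.
pose th := v 0 k / z 0 k; have th0 : 0 <= th by rewrite divr_ge0 // ltW.
pose v' := v + (- th) *: z.
have v'E i : v' 0 i = v 0 i - th * z 0 i by rewrite !mxE mulNr.
have v'U : v' *m U = v *m U by rewrite mulmxDl -scalemxAl zU scaler0 addr0.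
have v'0 i : 0 <= v' 0 i.
  rewrite v'E; have [zi|zi] := ltP 0 (z 0 i); last by have := v0 i; nra.
  by have := kmin i zi; rewrite ler_pdivlMr // => h; rewrite subr_ge0.
have v'k : v' 0 k = 0 by rewrite v'E /th divfK ?subrr // gt_eqF.
have : (#|S v'| < #|S v|)%N.
  apply: proper_card; apply/properP; split.
    apply/fintype.subsetP => i; rewrite !inE; apply: contraNneq => vi.
    by rewrite v'E vi zS ?mulr0 ?subr0 // inE vi eqxx.
  exists k; rewrite !inE ?v'k ?eqxx //.
  by apply: contraTneq zk => vk; rewrite zS ?ltxx // inE vk eqxx.
move=> lt; have [] := IH v' _ v'0; first by move: lt vK; lia.
move=> B [Bb B0 Bc]; exists B; rewrite -v'U; split=> //.
by apply: le_trans Bc _; rewrite costD costZ; nra.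
Qed.

Hypothesis c_generic : forall B j, isbasis B -> j \notin B ->
  cost (crd B (row j U)) != c j.

(** The bases whose reduced costs are all positive: lifted to the heights [c], every generator
    outside [B] lies strictly above the hyperplane through those in [B]. These are the cells of the
    lower hull. *)
Definition triang : {set {set 'I_N}} :=
  [set B | isbasis B && [forall j, (j \notin B) ==> (cost (crd B (row j U)) < c j)]]%SET.

Lemma triang_basis B : B \in triang -> isbasis B.
Proof. by rewrite inE => /andP[]. Qed.

Lemma triang_ex x : in_cone x ->
  (forall B i, isbasis B -> i \in B -> crd B x 0 i != 0) ->
  exists2 B, B \in triang & forall i, i \in B -> 0 < crd B x 0 i.
Proof.
move=> [v v0 xE] gen.
pose good := [pred B | isbasis B && [forall i, 0 <= crd B x 0 i]].
have [B0 [B0b B00 _]] := caratheodory v0; rewrite -xE in B00.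
have gB0 : good B0 by rewrite /= B0b; apply/forallP.
have [B /andP[Bb /forallP B_ge0] Bmin] :=
  @Order.TotalTheory.arg_minP _ R _ B0 good (fun B => cost (crd B x)) gB0.
have xU : (x <= U)%MS by rewrite xE submxMl.
have Bpos i : i \in B -> 0 < crd B x 0 i by move=> iB; rewrite lt_def gen //= B_ge0.
exists B => //; rewrite inE Bb /=; apply/forallP => j; apply/implyP => jB.
rewrite lt_neqAle c_generic //= leNgt; apply/negP => cj.
pose z := crd B (row j U) - delta_mx 0 j.
have zU : z *m U = 0 by rewrite mulmxBl crdK ?row_sub // -rowE subrr.
(* Moving along - z brings in the generator [j] and saves cost; it is feasible for a short while
   because [x] has strictly positive coordinates on [B]. [caratheodory] then returns to a basis. *)
have cz : 0 < cost z.
  rewrite /z costD -scaleN1r costZ mulN1r.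
  suff -> : cost (delta_mx 0 j) = c j by lra.
  rewrite /cost (bigD1 j) //= mxE !eqxx mul1r big1 ?addr0 // => i ij.
  by rewrite mxE (negbTE ij) andbF mul0r.
have [th th0 thP] : exists2 th, 0 < th & forall i e', 0 < e' -> e' <= th ->
    0 <= crd B x 0 i - e' * z 0 i.
  apply: small_all => i; have [zi|zi] := leP (z 0 i) 0.
    by exists 1 => // e' e'0 _; have := B_ge0 i; nra.
  have iB : i \in B.
    apply: contraTT zi => iB; rewrite -leNgt /z mxE (crd_supported _ iB).
    by rewrite !mxE add0r oppr_le0 ler0n.
  exists (crd B x 0 i / z 0 i); first by rewrite divr_gt0 // Bpos.
  by move=> e' _; rewrite ler_pdivlMr // subr_ge0.
pose v' := crd B x + (- th) *: z.
have v'0 i : 0 <= v' 0 i.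
  have -> : v' 0 i = crd B x 0 i - th * z 0 i by rewrite /v' mxE [X in _ + X]mxE mulNr.
  exact: thP.
have v'U : v' *m U = x by rewrite mulmxDl -scalemxAl zU scaler0 addr0 crdK.
have [B' [B'b B'0 B'c]] := caratheodory v'0; rewrite v'U in B'0 B'c.
have gB' : good B' by rewrite /= B'b; apply/forallP.
have := Bmin _ gB'; move: B'c; rewrite costD costZ; nra.
Qed.

(** [cost (crd B _)] is linear on the span and lies below the prices [c], with equality exactly at
    the generators in [B]. Expanding [x] in [B'] with positive coefficients gives the bound and its
    equality case; used both ways it makes the cell of [x] unique. *)
Lemma triang_cost_le B B' x : B \in triang -> B' \in triang -> (x <= U)%MS ->
  (forall i, i \in B' -> 0 < crd B' x 0 i) ->
  cost (crd B x) <= cost (crd B' x) ?= iff (B' \subset B).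
Proof.
rewrite !inE => /andP[Bb /forallP Bc] /andP[B'b _] xU pos.
have cB i : cost (crd B (row i U)) <= c i ?= iff (i \in B).
  have [iB|iB] := boolP (i \in B); last first.
    have := Bc i; rewrite iB /= => lt; split; [exact: ltW | exact: lt_eqF].
  suff -> : cost (crd B (row i U)) = c i by split; [exact: lexx | exact: eqxx].
  rewrite crd_row // /cost (bigD1 i) //= mxE !eqxx mul1r big1 ?addr0 // => j ji.
  by rewrite mxE (negbTE ji) andbF mul0r.
have E : cost (crd B x) = \sum_(i in B') crd B' x 0 i * cost (crd B (row i U)).
  rewrite -{1}(crdK B'b xU) mulmx_sum_row.
  have -> : crd B (\sum_i crd B' x 0 i *: row i U)
          = \sum_i crd B' x 0 i *: crd B (row i U).
    elim/big_rec2: _ => [|i y1 y2 _ <-]; first by rewrite /crd !mul0mx.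
    by rewrite crdD crdZ.
  rewrite (bigID (mem B')) /= [X in _ + X]big1 ?addr0 => [|i iB']; last first.
    by rewrite (crd_supported _ iB') scale0r.
  elim/big_rec2: _ => [|i y1 y2 _ <-]; first by rewrite /cost big1 // => i _; rewrite mxE mul0r.
  by rewrite costD costZ.
have E' : cost (crd B' x) = \sum_(i in B') crd B' x 0 i * c i.
  rewrite /cost (bigID (mem B')) /= [X in _ + X]big1 ?addr0 // => i iB'.
  by rewrite (crd_supported _ iB') mul0r.
have -> : (B' \subset B) = [forall (i | i \in B'), i \in B].
  by apply/fintype.subsetP/forall_inP.
rewrite E E'; apply: leif_sum => i iB'.
have [le eq] := cB i; have p := pos i iB'.
by split; [rewrite ler_pM2l | rewrite -eq (inj_eq (mulfI (lt0r_neq0 p)))].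
Qed.

Lemma triang_uniq B B' x : B \in triang -> B' \in triang -> (x <= U)%MS ->
  (forall i, i \in B -> 0 < crd B x 0 i) ->
  (forall i, i \in B' -> 0 < crd B' x 0 i) -> B = B'.
Proof.
move=> BT B'T xU p p'.
have [l1 e1] := triang_cost_le BT B'T xU p'.
have [l2 e2] := triang_cost_le B'T BT xU p.
have E : cost (crd B x) = cost (crd B' x) by apply/le_anti/andP.
by apply/eqP; rewrite finset.eqEsubset -e1 -e2 E eqxx.
Qed.

End Triangulation.

(** * Half-open cells obtained by perturbation *)

Definition lexpos (R : realType) (a b : R) := (0 < a) || (a == 0) && (0 < b).

(** When [p] has nonzero coordinates on [B], this says that [x + ep *: p] lies in the relative
    interior of the cone on [B] for all small ep > 0. *)
Definition half_open (R : realType) (N n : nat) (U : 'M[R]_(N, n))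
    (p : 'rV[R]_n) (B : {set 'I_N}) (x : 'rV[R]_n) :=
  [forall (i | i \in B), lexpos (crd U B x 0 i) (crd U B p 0 i)].

Lemma lexpos_small (R : realType) (a b : R) : b != 0 ->
  exists2 e0, 0 < e0 & forall e, 0 < e -> e <= e0 ->
    (a + e * b != 0) /\ ((0 < a + e * b) = lexpos a b).
Proof.
move=> b0; rewrite /lexpos; have [->|a0] := eqVneq a 0.
  exists 1 => // e e0 _; rewrite add0r ltxx /= pmulr_rgt0 //; split=> //.
  by rewrite mulf_neq0 // lt0r_neq0.
exists (`|a| / (2 * `|b|)); first by rewrite divr_gt0 ?mulr_gt0 ?normr_gt0.
move=> e e0; rewrite ler_pdivlMr ?mulr_gt0 ?normr_gt0 //= orbF => le.
have eb : `|e * b| * 2 <= `|a| by rewrite normrM (gtr0_norm e0); lra.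
have := ler_norm (e * b); have := ler_norm (- (e * b)); rewrite normrN.
have [a1|a1|a1] := ltgtP a 0; last by rewrite a1 eqxx in a0.
  move: eb; rewrite (ltr0_norm a1) => eb l1 l2.
  have lt : a + e * b < 0 by lra.
  by rewrite lt_eqF // ltNge ltW.
move: eb; rewrite (gtr0_norm a1) => eb l1 l2.
have lt : 0 < a + e * b by lra.
by rewrite gt_eqF.
Qed.

(* A generic perturbation of x lies in the interior of a single simplicial
   cone of the triangulation; perturbing by q or by - q gives the half-open
   decompositions of the cone and of its relative interior. *)
Lemma half_open_decomposition (R : realType) (N n : nat) (U : 'M[R]_(N, n))
    (eta : 'cV[R]_n) (e : R) : 0 < e -> U *m eta = const_mx e ->
  exists (q : 'rV[R]_N) (T : {set {set 'I_N}}),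
  [/\ forall i, 0 < q 0 i,
      forall B, B \in T -> isbasis U B,
      forall B i, B \in T -> i \in B -> crd U B (q *m U) 0 i != 0,
      forall x, (x <= U)%MS -> `[< in_cone U x >]%:R
        = \sum_(B in T) (half_open U (q *m U) B x)%:R :> R
    & forall x, (x <= U)%MS ->
      `[< exists2 ep, 0 < ep & in_cone U (x - ep *: (q *m U)) >]%:R
        = \sum_(B in T) (half_open U (- (q *m U)) B x)%:R :> R].
Proof.
move=> e0 Ue.
(* Prices on the moment curve, for which no reduced cost outside a basis vanishes. *)
have [sc sc0 scP] : exists2 s : R, 0 < s &
    forall Bj : {set 'I_N} * 'I_N, isbasis U Bj.1 && (Bj.2 \notin Bj.1) ->
      \sum_i (crd U Bj.1 (row Bj.2 U) - delta_mx 0 Bj.2) 0 i * s ^+ i != 0.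
  apply: generic_power => -[B j] /= /andP[_ jB].
  apply: contraTneq isT => /rowP/(_ j); rewrite mxE crd_supported //.
  by rewrite !mxE !eqxx add0r => /eqP; rewrite oppr_eq0 oner_eq0.
pose c (i : 'I_N) := sc ^+ i.
have cg B j : isbasis U B -> j \notin B -> cost c (crd U B (row j U)) != c j.
  move=> Bb jB; have /scP /= : isbasis U (B, j).1 && ((B, j).2 \notin (B, j).1) by rewrite /= Bb.
  apply: contraNneq => E; under eq_bigr do rewrite mxE mulrDl.
  rewrite big_split /= -/(cost c _) E (bigD1 j) //= !mxE !eqxx big1 => [|i ij].
    by rewrite addr0 mulN1r subrr.
  by rewrite !mxE (negbTE ij) andbF oppr0 mul0r.
(* A second point of the curve gives a positive combination [q] of the generators that lies on no
   facet hyperplane of any basis cone; the form attached to (B, j) is nonzero because its entry at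
   [j] is 1. *)
have [sq sq0 sqP] : exists2 s : R, 0 < s &
    forall Bj : {set 'I_N} * 'I_N, isbasis U Bj.1 && (Bj.2 \in Bj.1) ->
      \sum_i (\row_i crd U Bj.1 (row i U) 0 Bj.2) 0 i * s ^+ i != 0.
  apply: generic_power => -[B j] /= /andP[Bb jB].
  apply: contraTneq isT => /rowP/(_ j); rewrite mxE crd_row // !mxE !eqxx.
  by move/eqP; rewrite oner_eq0.
pose q : 'rV[R]_N := \row_i sq ^+ i.
have q0 i : 0 < q 0 i by rewrite mxE exprn_gt0.
have crdq B j : isbasis U B -> j \in B -> crd U B (q *m U) 0 j != 0.
  move=> Bb jB; have /sqP /= : isbasis U (B, j).1 && ((B, j).2 \in (B, j).1) by rewrite /= Bb.
  congr (_ != _); rewrite mulmx_sum_row.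
  have -> : crd U B (\sum_i q 0 i *: row i U) = \sum_i q 0 i *: crd U B (row i U).
    elim/big_rec2: _ => [|i y1 y2 _ <-]; first by rewrite /crd !mul0mx.
    by rewrite crdD crdZ.
  by rewrite summxE; apply: eq_bigr => i _; rewrite [RHS]mxE mulrC; congr (_ * _); rewrite mxE.
have qU : (q *m U <= U)%MS by exact: submxMl.
have cone_le x : in_cone U x -> (x <= U)%MS by case=> v _ ->; exact: submxMl.
have coneP B x : isbasis U B -> (x <= U)%MS ->
    (forall i, i \in B -> 0 <= crd U B x 0 i) -> in_cone U x.
  move=> Bb xU h; exists (crd U B x); last by rewrite crdK.
  by move=> i; have [/h//|iB] := boolP (i \in B); rewrite crd_supported.
have coneD x y : in_cone U x -> in_cone U y -> in_cone U (x + y).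
  move=> [v v0 ->] [w w0 ->]; exists (v + w); last by rewrite mulmxDl.
  by move=> i; rewrite mxE addr_ge0.
have coneq ep : 0 <= ep -> in_cone U (ep *: (q *m U)).
  move=> ep0; exists (ep *: q); last by rewrite scalemxAl.
  by move=> i; rewrite mxE mulr_ge0 // ltW.
have pert p x : (p = q *m U \/ p = - (q *m U)) -> exists2 ep0, 0 < ep0 &
    forall Bj : {set 'I_N} * 'I_N, forall ep, 0 < ep -> ep <= ep0 ->
      isbasis U Bj.1 -> Bj.2 \in Bj.1 ->
      (crd U Bj.1 (x + ep *: p) 0 Bj.2 != 0) /\
      ((0 < crd U Bj.1 (x + ep *: p) 0 Bj.2)
         = lexpos (crd U Bj.1 x 0 Bj.2) (crd U Bj.1 p 0 Bj.2)).
  move=> pq; apply: small_all => -[B j] /=.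
  have [Bb|] := boolP (isbasis U B); last by exists 1.
  have [jB|] := boolP (j \in B); last by exists 1.
  have pj : crd U B p 0 j != 0.
    case: pq => ->; first exact: crdq.
    by rewrite -scaleN1r crdZ mxE mulN1r oppr_eq0 crdq.
  have [ep0 h1 h2] := lexpos_small (crd U B x 0 j) pj; exists ep0 => // ep ep1 ep2 _ _.
  rewrite crdD crdZ mxE [X in _ + X]mxE; exact: h2.
pose T := triang U c.
have Tb B : B \in T -> isbasis U B by exact: triang_basis.
(* For small ep, [x + ep *: p] has no zero coordinate in any basis, so if it is in the cone it is
   interior to exactly one cell. *)
have count p x : (p = q *m U \/ p = - (q *m U)) -> (x <= U)%MS ->
    `[< exists2 ep0, 0 < ep0 & forall ep, 0 < ep -> ep <= ep0 -> in_cone U (x + ep *: p) >]%:R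
    = \sum_(B in T) (half_open U p B x)%:R :> R.
  move=> pq xU; have [ep0 ep00 hep] := pert p x pq.
  have pU : (p <= U)%MS by case: pq => ->; rewrite ?eqmx_opp.
  have xpU ep : ((x + ep *: p)%R <= U)%MS by rewrite addmx_sub // scalemx_sub.
  have hoE B ep : B \in T -> 0 < ep -> ep <= ep0 ->
      half_open U p B x <-> forall i, i \in B -> 0 < crd U B (x + ep *: p) 0 i.
    move=> BT ep1 ep2; split=> [/forall_inP h i iB|h].
      by have [_ ->] := hep (B, i) ep ep1 ep2 (Tb _ BT) iB; exact: h.
    by apply/forall_inP => i iB; have [_ <-] := hep (B, i) ep ep1 ep2 (Tb _ BT) iB; exact: h.
  have uniqT B B' : B \in T -> B' \in T -> half_open U p B x -> half_open U p B' x -> B = B'.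
    move=> BT B'T /(hoE _ ep0 BT ep00 (lexx _)) h /(hoE _ ep0 B'T ep00 (lexx _)) h'.
    exact: triang_uniq BT B'T (xpU ep0) h h'.
  case: asboolP => [[ep1 ep10 hc]|nc].
    pose ep := Num.min ep0 ep1.
    have ep_gt0 : 0 < ep by rewrite lt_min ep00.
    have le0 : ep <= ep0 by rewrite ge_min lexx.
    have le1 : ep <= ep1 by rewrite ge_min lexx orbT.
    have gen B i : isbasis U B -> i \in B -> crd U B (x + ep *: p) 0 i != 0.
      by move=> Bb iB; have [] := hep (B, i) ep ep_gt0 le0 Bb iB.
    have [B BT Bp] := triang_ex e0 Ue cg (hc ep ep_gt0 le1) gen.
    have hB : half_open U p B x by apply/(hoE _ ep BT ep_gt0 le0).
    rewrite (bigD1 B) //= hB big1 ?addr0 // => B' /andP[B'T B'B].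
    case h' : half_open => //; have := uniqT _ _ B'T BT h' hB.
    by move=> E; rewrite E eqxx in B'B.
  rewrite big1 // => B BT; case h : half_open => //; case: nc.
  exists ep0 => // ep ep1 ep2; apply: (coneP B); [exact: Tb | exact: xpU |].
  by move=> i iB; apply/ltW; move/(hoE _ ep BT ep1 ep2): h; apply.
exists q, T; split=> //.
- by move=> B i BT; apply: crdq; apply: Tb.
- move=> x xU; rewrite -count //; last by left.
  congr (nat_of_bool _)%:R; apply: asbool_equiv_eq; split=> [xC|[ep ep0 h]].
    by exists 1 => // ep ep0 _; apply: coneD => //; apply: coneq; exact: ltW.
  (* This replaces closedness of the cone: some cell counts [x], and its coordinates there are then
     nonnegative. *)
  have : \sum_(B in T) (half_open U (q *m U) B x)%:R != 0 :> R.
    rewrite -count //; last by left.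
    by rewrite (asboolT (ex_intro2 _ _ ep ep0 h)) oner_eq0.
  apply: contraNP => nx; rewrite big1 // => B BT; case hB : half_open => //.
  case: nx; apply: (coneP B) => //; first exact: Tb.
  move=> i iB; move/forall_inP: hB => /(_ i iB); rewrite /lexpos.
  by case/orP => [/ltW|/andP[/eqP-> _]].
- move=> x xU; rewrite -count //; last by right.
  congr (nat_of_bool _)%:R; apply: asbool_equiv_eq; split=> [[ep ep0 h]|[ep ep0 h]].
    exists ep => // ep' ep'0 le.
    have -> : x + ep' *: - (q *m U) = (x - ep *: (q *m U)) + (ep - ep') *: (q *m U).
      by rewrite scalerBl scalerN addrA subrK.
    by apply: coneD => //; apply: coneq; rewrite subr_ge0.
  by exists ep => //; rewrite -scalerN; apply: h.
Qed.

(** * Lattice points of a cone and reciprocity *)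

Section LatticeCones.
Variables (R : realType) (d N : nat).
Local Notation X := 'rV[int]_(d + 1).

Definition realv (x : X) : 'rV[R]_(d + 1) := map_mx intr x.

Definition htz (x : X) : int := x 0 (rshift d ord0).

Fact htz_is_additive : zmod_morphism htz.
Proof. by move=> x y; rewrite /htz !mxE. Qed.
HB.instance Definition _ := GRing.isZmodMorphism.Build X int htz htz_is_additive.

Lemma realvB x y : realv (x - y) = realv x - realv y.
Proof. exact: map_mxB. Qed.

Lemma realvN x : realv (- x) = - realv x.
Proof. exact: map_mxN. Qed.

Lemma realv_inj : injective realv.
Proof.
by move=> x y /rowP E; apply/rowP => i; have := E i; rewrite !mxE => /intr_inj.
Qed.

Lemma bounded_finite (M : R) :
  finite_set [set x : X | forall j, `|realv x 0 j| <= M].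
Proof.
have [M0|M0] := ltP M 0.
  have -> : [set x : X | forall j, `|realv x 0 j| <= M] = set0.
    rewrite -subset0 => x /(_ (rshift d ord0)) /le_lt_trans /(_ M0).
    by rewrite normr_lt0.
  exact: finite_set0.
pose K := Num.Def.archi_bound M.
pose dec (g : {ffun 'I_(d + 1) -> 'I_(K + K).+1}) : X := \row_j ((g j)%:Z - K%:Z).
apply: (@sub_finite_set _ _ [set dec g | g in [set: {ffun 'I_(d + 1) -> 'I_(K + K).+1}]]).
  move=> x /= xM.
  have xK j : - K%:Z <= x 0 j <= K%:Z.
    have := xM j; rewrite mxE => /le_lt_trans /(_ (archi_boundP M0)).
    rewrite -intr_norm -[_%:R]/(K%:Z%:~R) ltr_int; lia.
  exists [ffun j => inord (absz (x 0 j + K%:Z))] => //.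
  apply/rowP => j; rewrite mxE ffunE inordK; have := xK j; lia.
exact: finite_image.
Qed.

Variables (Z : 'M[int]_(N, d + 1)) (e : nat).
Hypothesis e_gt0 : (0 < e)%N.
Hypothesis Z_ht : forall i, Z i (rshift d ord0) = e%:Z.
Let U : 'M[R]_(N, d + 1) := map_mx intr Z.

Let U_eta : U *m (delta_mx (rshift d ord0) 0 : 'cV[R]_(d + 1)) = const_mx e%:R.
Proof.
apply/matrixP => i j; rewrite !mxE (bigD1 (rshift d ord0)) //= !mxE eqxx !ord1.
rewrite Z_ht mulr1 big1 ?addr0 // => k kd.
by rewrite !mxE (negbTE kd) mulr0.
Qed.

Lemma ht_mulU v x : realv x = v *m U -> (htz x)%:~R = e%:R * \sum_i v 0 i.
Proof.
move=> E; have -> : (htz x)%:~R = realv x 0 (rshift d ord0) by rewrite mxE.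
rewrite E mxE mulr_sumr; apply: eq_bigr => i _.
by rewrite mxE Z_ht mulrC.
Qed.

Lemma mulU_finite (M : R) :
  finite_set [set x | exists2 v : 'rV[R]_N, (forall i, `|v 0 i| <= M) & realv x = v *m U].
Proof.
apply: sub_finite_set (bounded_finite (\sum_j \sum_i M * `|U i j|)).
move=> x /= [v vM E] j; rewrite E mxE.
have M0 i k : 0 <= M * `|U i k|.
  by rewrite mulr_ge0 ?normr_ge0 //; apply: le_trans (vM i).
apply: (@le_trans _ _ (\sum_i M * `|U i j|)).
  apply: le_trans (ler_norm_sum _ _ _) _; apply: ler_sum => i _.
  by rewrite normrM ler_wpM2r.
rewrite [leRHS](bigD1 j) //= lerDl; apply: sumr_ge0 => k _; exact: sumr_ge0.
Qed.

Definition cone_ind (x : X) : R := `[< in_cone U (realv x) >]%:R.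

(** For positive [q] this is the indicator of the relative interior of the cone. *)
Definition open_ind (q : 'rV[R]_N) (x : X) : R :=
  `[< exists2 ep, 0 < ep & in_cone U (realv x - ep *: (q *m U)) >]%:R.

Lemma cone_fin : hfin htz cone_ind.
Proof.
move=> n; apply: sub_finite_set (mulU_finite (n%:~R / e%:R)) => x /= [hx].
rewrite /cone_ind; case: asboolP => // -[v v0 E] _; exists v => // i.
rewrite ger0_norm //; have := ht_mulU E; rewrite hx => ->.
rewrite mulrC mulKf ?pnatr_eq0 -?lt0n // (bigD1 i) //= lerDl.
exact: sumr_ge0.
Qed.

Lemma open_fin (q : 'rV[R]_N) : (forall i, 0 < q 0 i) -> hfin htz (open_ind q).
Proof.
move=> q0; apply: hfin_sub cone_fin => x; rewrite /open_ind /cone_ind.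
case: asboolP => // -[ep ep0 [v v0 E]] _; rewrite asboolT; first exact/eqP/oner_neq0.
exists (v + ep *: q); last by rewrite mulmxDl -E -scalemxAl subrK.
by move=> i; rewrite !mxE addr_ge0 // mulr_ge0 // ltW.
Qed.

Let iter_bdiff_sum r (I : finType) (P : pred I) (F : I -> int -> R) n :
  iter r (bdiff e) (fun n => \sum_(i | P i) F i n) n
  = \sum_(i | P i) iter r (bdiff e) (F i) n.
Proof. by elim: r n => //= r IH n; rewrite /bdiff !IH sumrB. Qed.

(** This makes the two perturbations complementary: a coordinate fails the test at [x] for [q]
    exactly when it passes it at - x for - q. *)
Lemma lexposN (a b : R) : b != 0 -> lexpos (- a) (- b) = ~~ lexpos a b.
Proof.
rewrite /lexpos !oppr_gt0 oppr_eq0 => b0.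
by case: (ltgtP a 0) => //=; rewrite ltNge le_eqVlt eq_sym (negbTE b0).
Qed.

Section HalfOpen.
Variables (q : 'rV[R]_N) (B : {set 'I_N}).
Hypothesis Bb : isbasis U B.
Hypothesis qB : forall i, i \in B -> crd U B (q *m U) 0 i != 0.

Let al (k : 'I_#|B|) (x : X) : R := (realv x *m pinvmx (rows_of U B)) 0 k.
Let mu (k : 'I_#|B|) : X := row (enum_val k) Z.
Let V (x : X) : bool := (realv x <= U)%MS.
Let ray (k : 'I_#|B|) (a : R) := lexpos a (crd U B (q *m U) 0 (enum_val k)).

Let realv_mu k : realv (mu k) = row k (rows_of U B).
Proof. by apply/rowP => j; rewrite !mxE. Qed.

Let crd_al x k : crd U B (realv x) 0 (enum_val k) = al k x.
Proof. by rewrite /crd mul_sel. Qed.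

Let alB i j x : al i (x - mu j) = al i x - (i == j)%:R.
Proof.
rewrite /al realvB realv_mu mulmxBl mxE; congr (_ + _); rewrite mxE; congr (- _).
case/andP: Bb => Bf _; rewrite -row_mul mulmxVp // !mxE; congr (_%:R).
by rewrite eq_sym.
Qed.

Let VB j x : V (x - mu j) = V x.
Proof.
rewrite /V realvB; have uU : (realv (mu j) <= U)%MS.
  by rewrite realv_mu; apply: submx_trans (row_sub _ _) (rowsub_sub _ _).
apply/idP/idP => h; last by rewrite addmx_sub // eqmx_opp.
by rewrite -[realv x](subrK (realv (mu j))) addmx_sub.
Qed.

Let sum_al x : \sum_i crd U B (realv x) 0 i = \sum_k al k x.
Proof.
rewrite (bigID (mem B)) /= [X in _ + X]big1 ?addr0 => [|i iB].
  by rewrite big_enum_val; apply: eq_bigr => k _; rewrite crd_al.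
exact: crd_supported.
Qed.

Let ht_al x : V x -> (htz x)%:~R = e%:R * \sum_i al i x.
Proof. by move=> Vx; rewrite -sum_al; apply: ht_mulU; rewrite crdK. Qed.

Let V_fin (M : R) : finite_set [set x | V x /\ forall i, `|al i x| <= M].
Proof.
apply: sub_finite_set (mulU_finite (Num.max M 0)) => x /= [Vx h].
exists (crd U B (realv x)); last by rewrite crdK.
move=> i; rewrite le_max; have [iB|iB] := boolP (i \in B).
  by rewrite -(enum_rankK_in iB iB) crd_al h.
by rewrite crd_supported // normr0 lexx orbT.
Qed.

Let pair := simplicial_pair al V ray.

Lemma pairE x : pair x = (V x)%:R *
  ((half_open U (q *m U) B (realv x))%:R
   - (-1) ^+ \rank U * (half_open U (- (q *m U)) B (realv (- x)))%:R).
Proof.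
have hoE p y : half_open U p B y = [forall k : 'I_#|B|,
    lexpos (crd U B y 0 (enum_val k)) (crd U B p 0 (enum_val k))].
  apply/forall_inP/forallP => [h k|h i iB]; first by apply: h; exact: enum_valP.
  by have := h (enum_rank_in iB i); rewrite enum_rankK_in.
have cB : #|'I_#|B| | = \rank U by rewrite card_ord (card_basis Bb).
rewrite /pair /simplicial_pair cB !hoE.
have -> : [forall i, ray i (al i x)] = [forall k : 'I_#|B|,
    lexpos (crd U B (realv x) 0 (enum_val k)) (crd U B (q *m U) 0 (enum_val k))].
  by apply: eq_forallb => k; rewrite crd_al.
have -> : [forall i, ~~ ray i (al i x)] = [forall k : 'I_#|B|,
    lexpos (crd U B (realv (- x)) 0 (enum_val k)) (crd U B (- (q *m U)) 0 (enum_val k))].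
  apply: eq_forallb => k.
  have crdN y : crd U B (- y) 0 (enum_val k) = - crd U B y 0 (enum_val k).
    by rewrite -scaleN1r crdZ mxE mulN1r.
  by rewrite realvN !crdN lexposN ?crd_al // qB // enum_valP.
by case: (V x); rewrite /= ?mul1r // mul0r mulr0 subrr.
Qed.

Lemma pair_fin : hfin htz pair.
Proof.
apply: (simplicial_fin (e := e) (mu := mu)) => //.
- by move=> k a a0; rewrite /ray /lexpos a0.
- by move=> k a a0; rewrite /ray /lexpos ltNge ltW //= lt_eqF.
Qed.

Lemma pair_kill m f n : deg_lt m.+1 f ->
  iter (\rank U + m) (bdiff e) (hsum htz (fun x => f x * pair x)) n = 0.
Proof.
have <- : #|'I_#|B| | = \rank U by rewrite card_ord (card_basis Bb).
move=> fm.
apply: (simplicial_kill (mu := mu)) => //.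
- by move=> k; rewrite [LHS]mxE Z_ht.
- by move=> k a a0; rewrite /ray /lexpos a0.
- by move=> k a a0; rewrite /ray /lexpos ltNge ltW //= lt_eqF.
Qed.

End HalfOpen.

(** Summing the simplicial pairs over the triangulation gives the indicator of the cone minus a
    signed indicator of the reflected interior, and each pair is killed by the [r] differences. *)
Lemma cone_reciprocity : exists2 q : 'rV[R]_N, forall i, 0 < q 0 i &
  forall m f n, deg_lt m.+1 f -> (forall x, f (- x) = (-1) ^+ m * f x) ->
  let r := (\rank U + m)%N in
  iter r (bdiff e) (hsum htz (fun x => f x * cone_ind x)) n
  = iter r (bdiff e) (hsum htz (fun x => f x * open_ind q x)) ((e * r)%:Z - n).
Proof.
have e0 : 0 < e%:R :> R by rewrite ltr0n.
have [q [T [q0 Tb Tq Tc To]]] := half_open_decomposition e0 U_eta.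
exists q => // m f n fm fN r.
pose k := \rank U.
pose pr B := simplicial_pair (fun k (x : X) => (realv x *m pinvmx (rows_of U B)) 0 k)
  (fun x => (realv x <= U)%MS)
  (fun k a => lexpos a (crd U B (q *m U) 0 (enum_val k))).
have prf B : B \in T -> hfin htz (fun x => f x * pr B x).
  by move=> BT; apply: hfinMl; apply: pair_fin; exact: Tb.
have E x : cone_ind x - (-1) ^+ k * open_ind q (- x) = \sum_(B in T) pr B x.
  have -> : \sum_(B in T) pr B x = \sum_(B in T) (realv x <= U)%MS%:R *
      ((half_open U (q *m U) B (realv x))%:R
      - (-1) ^+ k * (half_open U (- (q *m U)) B (realv (- x)))%:R).
    by apply: eq_bigr => B BT; apply: pairE; [exact: Tb | move=> i; exact: Tq].
  rewrite -mulr_sumr sumrB -mulr_sumr.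
  (* The decompositions hold only on the span of the generators; off it both indicators vanish. *)
  have [xU|xU] := boolP (realv x <= U)%MS.
    by rewrite mul1r -Tc // -To // realvN eqmx_opp.
  rewrite mul0r /cone_ind /open_ind !asboolF ?mulr0 ?subr0 //.
    case=> ep _ [v _ Ev]; case/negP: xU; rewrite -[realv x]opprK -realvN eqmx_opp.
    by rewrite -[realv (- x)](subrK (ep *: (q *m U))) Ev addmx_sub ?scalemx_sub ?submxMl.
  by case=> v _ Ev; case/negP: xU; rewrite Ev submxMl.
have kill : iter r (bdiff e)
    (fun n => hsum htz (fun x => f x * cone_ind x) n
       - (-1) ^+ k * hsum htz (fun x => f x * open_ind q (- x)) n) n = 0.
  have -> : (fun n => hsum htz (fun x => f x * cone_ind x) n
       - (-1) ^+ k * hsum htz (fun x => f x * open_ind q (- x)) n)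
     = (fun n => \sum_(B in T) hsum htz (fun x => f x * pr B x) n).
    apply/funext => j; have [_ <-] := hsum_sum (ht := htz) (index_enum _) j prf.
    have ofin : hfin htz (fun x => f x * open_ind q (- x)).
      apply: hfinMl => i.
      have := finite_image (fun x : X => - x) (open_fin q0 (- i)).
      apply: sub_finite_set => x /= [hx ox]; exists (- x); last by rewrite opprK.
      by rewrite -hx (raddfN htz).
    rewrite -mulNr -hsumZ // -hsumD; [|exact: hfinMl cone_fin|exact: hfinMl].
    by apply: eq_hsum => x _; rewrite -mulr_sumr -E; ring.
  by rewrite iter_bdiff_sum big1 // => B BT; apply: pair_kill => //; exact: Tb.
have rev j : hsum htz (fun x => f x * open_ind q (- x)) j
    = (-1) ^+ m * hsum htz (fun x => f x * open_ind q x) (- j).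
  rewrite -hsumZ; last exact/hfinMl/open_fin.
  rewrite /hsum [RHS](@reindex_fsbig _ _ _ _ _ (fun x : X => - x) [set x | htz x = j]).
    apply: eq_fsbigr => x _; rewrite fN !mulrA -exprD -signr_odd addnn odd_double.
    by rewrite mul1r.
  split=> [x /= <-|x y _ _ /oppr_inj//|x /= hx]; first by rewrite (raddfN htz).
  by exists (- x); rewrite ?opprK //= -[j]opprK -hx (raddfN htz).
move: kill; rewrite iter_bdiffB iter_bdiffZ => /eqP; rewrite subr_eq0 => /eqP ->.
have -> : hsum htz (fun x => f x * open_ind q (- x))
   = (fun j => (-1) ^+ m * hsum htz (fun x => f x * open_ind q x) (- j)).
  exact/funext.
(* Signs: (-1)^k from the pairs, (-1)^m from the parity of [f] and (-1)^r from reversing [r]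
   differences cancel, as r = k + m. *)
rewrite iter_bdiffZ iter_bdiff_rev !mulrA -!exprD -[(k + m)%N]/r addnn.
by rewrite -signr_odd odd_double mul1r.
Qed.

End LatticeCones.

Arguments htz {d} x.

(** * Homogeneous polynomials as weights *)

Section Weights.
Variables (R : realType) (d : nat).

Lemma weval_homogE m (w : weight R d) x : homogeneous m w ->
  weval w x = \sum_(mm <- msupp w | mdeg mm == m) w@_mm * \prod_i x 0 i ^+ mm i.
Proof.
move=> /dhomogP wm; rewrite /weval mevalE big_seq_cond [RHS]big_seq_cond.
by apply: eq_bigl => mm; case: (boolP (mm \in _)) => //= /wm ->; rewrite eqxx.
Qed.

Lemma weval_deg m (w : weight R d) : homogeneous m w ->
  deg_lt m.+1 (fun x : 'rV[int]_(d + 1) => weval w (realv R x)).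
Proof.
move=> wm.
have -> : (fun x : 'rV[int]_(d + 1) => weval w (realv R x)) = (fun x =>
    \sum_(mm <- msupp w | mdeg mm == m) w@_mm * \prod_i realv R x 0 i ^+ mm i).
  by apply/funext => x; rewrite (weval_homogE _ wm).
elim: (msupp w) => [|mm s IH].
  rewrite (_ : (fun x => _) = fun=> 0); first exact: deg_lt0.
  by apply/funext => x; rewrite big_nil.
have [mE|mE] := eqVneq (mdeg mm) m; last first.
  rewrite (_ : (fun x => _) = (fun x : 'rV[int]_(d + 1) =>
    \sum_(mm <- s | mdeg mm == m) w@_mm * \prod_i realv R x 0 i ^+ mm i)) //.
  by apply/funext => x; rewrite big_cons (negbTE mE).
rewrite (_ : (fun x => _) = (fun x : 'rV[int]_(d + 1) =>
    w@_mm * \prod_i realv R x 0 i ^+ mm i +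
    \sum_(mm <- s | mdeg mm == m) w@_mm * \prod_i realv R x 0 i ^+ mm i)); last first.
  by apply/funext => x; rewrite big_cons mE eqxx.
apply: deg_ltD => //; rewrite -[m.+1]/(0 + m).+1; apply: deg_ltM; first exact: deg_lt_cst.
rewrite -mE mdegE.
elim: (index_enum _) => [|i r IHr].
  rewrite big_nil (_ : (fun x => _) = fun=> 1); first exact: deg_lt_cst.
  by apply/funext => x; rewrite big_nil.
rewrite (_ : (fun x => _) = (fun x : 'rV[int]_(d + 1) =>
    realv R x 0 i ^+ mm i * \prod_(i <- r) realv R x 0 i ^+ mm i)); last first.
  by apply/funext => x; rewrite big_cons.
rewrite big_cons; apply: deg_ltM => //; rewrite -[X in deg_lt X.+1]mul1n; apply: deg_ltX.
by move=> u v x; rewrite !mxE !rmorphD /=; ring.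
Qed.

Lemma wevalN m (w : weight R d) x : homogeneous m w ->
  weval w (- x) = (-1) ^+ m * weval w x.
Proof.
move=> wm; rewrite !(weval_homogE _ wm) mulr_sumr; apply: eq_bigr => mm /eqP <-.
rewrite mulrCA; congr (_ * _).
rewrite mdegE -prodrXr -big_split; apply: eq_bigr => i _ /=.
by rewrite mxE -[LHS]mulr1 -exprNn -mulN1r exprMn; ring.
Qed.

Lemma S_semiring_ge0 P (w : weight R d) x : S_semiring P w -> cone P x -> 0 <= weval w x.
Proof.
move=> [s [_ s0 ->]] Px; rewrite /weval raddf_sum big_seq; apply: sumr_ge0 => l ls.
exact: s0.
Qed.

End Weights.

(** * Theorems of the alternative, vertices and denominators *)

Section Vertices.
Variables (R : realType) (d : nat).
Implicit Types (c x y z : 'rV[R]_d).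

Definition dot c x := \sum_i c 0 i * x 0 i.

Lemma dotDl c1 c2 x : dot (c1 + c2) x = dot c1 x + dot c2 x.
Proof. by rewrite -big_split; apply: eq_bigr => i _; rewrite mxE mulrDl. Qed.

Lemma dotDr c x1 x2 : dot c (x1 + x2) = dot c x1 + dot c x2.
Proof. by rewrite -big_split; apply: eq_bigr => i _; rewrite mxE mulrDr. Qed.

Lemma dotZl a c x : dot (a *: c) x = a * dot c x.
Proof. by rewrite mulr_sumr; apply: eq_bigr => i _; rewrite mxE mulrA. Qed.

Lemma dotZr a c x : dot c (a *: x) = a * dot c x.
Proof. by rewrite mulr_sumr; apply: eq_bigr => i _; rewrite mxE mulrCA. Qed.

Lemma dot_sum (I : finType) c (F : I -> 'rV[R]_d) :
  dot c (\sum_i F i) = \sum_i dot c (F i).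
Proof.
elim/big_rec2: _ => [|i y1 y2 _ <-]; last by rewrite dotDr.
by rewrite /dot big1 // => i _; rewrite mxE mulr0.
Qed.

Lemma dot_gt0 x : x != 0 -> 0 < dot x x.
Proof.
move=> x0; rewrite lt_def; apply/andP; split; last first.
  by apply: sumr_ge0 => i _; rewrite -expr2 sqr_ge0.
apply: contraNneq x0 => /eqP; rewrite psumr_eq0 => [/allP h|i _]; last first.
  by rewrite -expr2 sqr_ge0.
apply/eqP/rowP => i; have := h i (mem_index_enum _); rewrite -expr2 sqrf_eq0 mxE.
by move/eqP.
Qed.

(** Gordan's alternative, by induction on the number of vectors: a functional positive on all but
    [z0] either can be corrected at [z0] or the problem is projected along [z0]. *)
Lemma gordan K (z : 'I_K -> 'rV[R]_d) :
  (exists c, forall i, 0 < dot c (z i)) \/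
  (exists a : 'I_K -> R,
     [/\ forall i, 0 <= a i, exists i, 0 < a i & \sum_i a i *: z i = 0]).
Proof.
elim: K z => [|K IH] z; first by left; exists 0 => -[].
pose z0 := z ord0; pose z1 i := z (lift ord0 i).
have ordcase (Q : 'I_K.+1 -> Prop) : Q ord0 -> (forall i, Q (lift ord0 i)) -> forall i, Q i.
  by move=> Q0 Q1 i; case: (unliftP ord0 i) => [j|] ->.
pose ext (a0 : R) (a : 'I_K -> R) (i : 'I_K.+1) := if unlift ord0 i is Some j then a j else a0.
have ext0 a0 a : ext a0 a ord0 = a0 by rewrite /ext unlift_none.
have extS a0 a j : ext a0 a (lift ord0 j) = a j by rewrite /ext liftK.
have [[c cz]|[a [a0 [i ai] az]]] := IH z1; last first.
  right; exists (ext 0 a); split.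
  - by apply: ordcase => [|j]; rewrite ?ext0 ?extS.
  - by exists (lift ord0 i); rewrite extS.
  - by rewrite big_ord_recl ext0 scale0r add0r; under eq_bigr do rewrite extS.
have tweak c1 c2 : 0 < dot c2 z0 -> (forall i, 0 < dot c1 (z1 i)) -> 0 <= dot c1 z0 ->
    exists c, forall i, 0 < dot c (z i).
  move=> h2 h1 h0.
  have [ep ep0 epP] : exists2 ep : R, 0 < ep & forall i ep', 0 < ep' -> ep' <= ep ->
      0 < dot c1 (z1 i) + ep' * dot c2 (z1 i).
    apply: small_all => i; have [p|p] := leP 0 (dot c2 (z1 i)).
      by exists 1 => // e' e'0 _; have := h1 i; nra.
    have n0 : 0 < - dot c2 (z1 i) by lra.
    exists (dot c1 (z1 i) / (2 * - dot c2 (z1 i))).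
      by rewrite divr_gt0 // mulr_gt0.
    move=> e' e'0; rewrite ler_pdivlMr; last by rewrite mulr_gt0.
    by have := h1 i; lra.
  exists (c1 + ep *: c2); apply: ordcase => [|i]; rewrite dotDl dotZl.
    by rewrite -/z0; nra.
  exact: epP.
have [p|n|zero] := ltgtP 0 (dot c z0).
- by left; exists c; apply: ordcase.
- pose al := - dot c z0; have al0 : 0 < al by rewrite /al; lra.
  (* The other vectors are moved along [z0] into the kernel of [c]; since [al] and the
     [dot c (z1 i)] are positive, a relation among the [z'] expands to one among the [z]. *)
  pose z' i := al *: z1 i + dot c (z1 i) *: z0.
  have cz' i : dot c (z' i) = 0 by rewrite dotDr !dotZr /al; ring.
  have [[c' c'z]|[a [a0 [i ai] az]]] := IH z'; last first.
    right; exists (ext (\sum_i a i * dot c (z1 i)) (fun i => a i * al)); split.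
    + apply: ordcase => [|j]; rewrite ?ext0 ?extS.
        by apply: sumr_ge0 => j _; rewrite mulr_ge0 // ltW.
      by rewrite mulr_ge0 // ltW.
    + by exists (lift ord0 i); rewrite extS mulr_gt0.
    + rewrite big_ord_recl ext0; under [X in _ + X]eq_bigr do rewrite extS.
      rewrite -[RHS]az scaler_suml -big_split; apply: eq_bigr => j _ /=.
      by rewrite /z' scalerDr !scalerA addrC.
  (* Adding a multiple of [c] changes nothing on the [z'], and this one makes the functional vanish
     at [z0]; a small multiple of - c then makes it positive there. *)
  left; pose c2 := c' + (dot c' z0 / al) *: c.
  have c2z0 : dot c2 z0 = 0.
    by rewrite dotDl dotZl -[dot c z0]opprK -/al mulrN divfK ?subrr // gt_eqF.
  apply: (tweak c2 (-1 *: c)).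
  + by rewrite dotZl; lra.
  + move=> i; have := c'z i.
    have -> : dot c' (z' i) = dot c2 (z' i) by rewrite dotDl dotZl cz' mulr0 addr0.
    by rewrite dotDr !dotZr c2z0 mulr0 addr0 pmulr_rgt0.
  + by rewrite c2z0.
- have [z00|z00] := eqVneq z0 0.
    right; exists (ext 1 (fun=> 0)); split.
    + by apply: ordcase => [|j]; rewrite ?ext0 ?extS.
    + by exists ord0; rewrite ext0.
    + rewrite big_ord_recl ext0 -/z0 z00 scaler0 add0r big1 // => j _.
      by rewrite extS scale0r.
  by left; apply: (tweak c z0) => //; [exact: dot_gt0 | rewrite zero].
Qed.

Lemma separation K (y : 'I_K -> 'rV[R]_d) p : ~ conv_hull y p ->
  exists c, forall j, dot c (y j) < dot c p.
Proof.
move=> np; have [[c cP]|[a [a0 [i ai] az]]] := gordan (fun j => p - y j).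
  exists c => j; have := cP j; rewrite -scaleN1r dotDr dotZr; lra.
case: np; pose A := \sum_j a j.
have A0 : 0 < A.
  rewrite /A (bigD1 i) //=; have : 0 <= \sum_(j | j != i) a j by apply: sumr_ge0.
  by lra.
exists (fun j => a j / A); split.
- by move=> j; rewrite divr_ge0 // ltW.
- by rewrite -mulr_suml divff // gt_eqF.
- move: az; under eq_bigr do rewrite scalerBr.
  rewrite sumrB -scaler_suml -/A => /eqP; rewrite subr_eq0 => /eqP E.
  under eq_bigr do rewrite mulrC -scalerA.
  by rewrite -scaler_sumr -E scalerA mulVf ?scale1r // gt_eqF.
Qed.

Lemma conv_hull_mem K (y : 'I_K -> 'rV[R]_d) i : conv_hull y (y i).
Proof.
exists (fun j => (j == i)%:R); split.
- by move=> j; rewrite ler0n.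
- by rewrite (bigD1 i) //= eqxx big1 ?addr0 // => j /negbTE->.
- rewrite (bigD1 i) //= eqxx scale1r big1 ?addr0 // => j /negbTE->.
  by rewrite scale0r.
Qed.

Lemma conv_hull_sub K L (y : 'I_K -> 'rV[R]_d) (z : 'I_L -> 'rV[R]_d) :
  (forall i, conv_hull z (y i)) -> conv_hull y `<=` conv_hull z.
Proof.
move=> /choice[b bP] x [a [a0 a1 ->]].
exists (fun j => \sum_i a i * b i j); split.
- move=> j; apply: sumr_ge0 => i _; rewrite mulr_ge0 //.
  by have [] := bP i.
- rewrite exchange_big -a1 /=; apply: eq_bigr => i _.
  by rewrite -mulr_sumr; have [_ -> _] := bP i; rewrite mulr1.
- under [RHS]eq_bigr do rewrite scaler_suml.
  rewrite exchange_big /=; apply: eq_bigr => i _.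
  have [_ _ {1}->] := bP i; rewrite scaler_sumr.
  by apply: eq_bigr => j _; rewrite scalerA.
Qed.

Lemma conv_hull_minimal K (y : 'I_K -> 'rV[R]_d) :
  exists L (z : 'I_L -> 'rV[R]_d), conv_hull z = conv_hull y /\
    forall i, ~ conv_hull (fun j => z (lift i j)) (z i).
Proof.
elim: K y => [|K IH] y; first by exists 0%N, y; split=> // -[].
have [[i yi]|h] := EM (exists i, conv_hull (fun j => y (lift i j)) (y i)); last first.
  by exists K.+1, y; split=> // i hi; apply: h; exists i.
have [L [z [zE zP]]] := IH (fun j => y (lift i j)); exists L, z; split=> //.
rewrite zE eqEsubset; split; apply: conv_hull_sub => j; first exact: conv_hull_mem.
case: (unliftP i j) => [k|] -> //.
exact: (@conv_hull_mem _ (fun j => y (lift i j))).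
Qed.

(** In a generating family without redundant points, each point is strictly separated from the
    others, and the separating functional exposes it as a vertex. *)
Lemma conv_hull_vertices K (y : 'I_K -> 'rV[R]_d) :
  exists L (z : 'I_L -> 'rV[R]_d), conv_hull z = conv_hull y /\
    forall i, vertex (conv_hull y) (z i).
Proof.
have [L [z [zE zP]]] := conv_hull_minimal y; exists L, z; split=> // i.
rewrite -zE; split; first exact: conv_hull_mem.
have [c cP] := separation (zP i); exists c => x [a [a0 a1 xE]] xz.
rewrite -/(dot c x) -/(dot c (z i)).
have le j : dot c (z j) <= dot c (z i).
  by case: (unliftP i j) => [k|] ->; [exact/ltW/cP | exact: lexx].
have E : dot c (z i) - dot c x = \sum_j a j * (dot c (z i) - dot c (z j)).
  under eq_bigr do rewrite mulrBr.
  rewrite sumrB -mulr_suml a1 mul1r xE dot_sum.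
  by under [X in _ - X]eq_bigr do rewrite dotZr.
rewrite lt_neqAle -subr_ge0 E; apply/andP; split; last first.
  by apply: sumr_ge0 => j _; rewrite mulr_ge0 // subr_ge0.
apply: contra_not_neq xz => cx.
have aj j : j != i -> a j = 0.
  move: E; rewrite cx subrr => /esym/eqP; rewrite psumr_eq0 => [/allP h|k _]; last first.
    by rewrite mulr_ge0 // subr_ge0.
  have := h j (mem_index_enum _); rewrite /= mulf_eq0 => /orP[/eqP//|].
  by case: (unliftP i j) => [k ->|->]; rewrite ?eqxx // subr_eq0 gt_eqF ?cP.
have ai : a i = 1 by move: a1; rewrite (bigD1 i) //= big1 ?addr0.
rewrite xE (bigD1 i) //= ai scale1r big1 ?addr0 // => j /aj ->.
by rewrite scale0r.
Qed.

Lemma vertex_dilate q (P : set 'rV[R]_d) v : (0 < q)%N -> vertex P v ->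
  vertex (dilate q P) (q%:R *: v).
Proof.
move=> q0 [Pv [c cP]]; split; first by exists v.
exists c => _ [x Px <-] xv; rewrite -/(dot c (q%:R *: x)) -/(dot c (q%:R *: v)) !dotZr.
by rewrite ltr_pM2l ?ltr0n //; apply: cP => // xv'; apply: xv; rewrite xv'.
Qed.

Lemma vertex_dilate_conv q K (y : 'I_K -> 'rV[R]_d) v :
  vertex (dilate q (conv_hull y)) v -> exists i, v = q%:R *: y i.
Proof.
move=> [[x [a [a0 a1 xE]] vE] [c cP]]; apply: contrapT => h.
have lt i : dot c (q%:R *: y i) < dot c v.
  apply: cP; first by exists (y i) => //; exact: conv_hull_mem.
  by move=> E; apply: h; exists i.
have := ltxx (dot c v); rewrite -{1}vE xE scaler_sumr dot_sum.
have -> : dot c v = \sum_i a i * dot c v by rewrite -mulr_suml a1 mul1r.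
have [i ai] : exists i, 0 < a i.
  apply: contrapT => na; have : \sum_i a i <= 0.
    by apply: sumr_le0 => i _; rewrite leNgt; apply/negP => ai; apply: na; exists i.
  by rewrite a1 ler10.
suff -> : \sum_i dot c (q%:R *: (a i *: y i)) < \sum_i a i * dot c v by [].
have tE j : dot c (q%:R *: (a j *: y j)) = a j * dot c (q%:R *: y j).
  by rewrite !dotZr mulrCA.
rewrite (bigD1 i) //= [ltRHS](bigD1 i) //= ltr_leD //.
  by rewrite tE ltr_pM2l.
by apply: ler_sum => j _; rewrite tE ler_wpM2l // ltW.
Qed.

Lemma rational_lattice_dilation (P : set 'rV[R]_d) : rational_polytope P ->
  exists q, lattice_dilation P q.
Proof.
move=> [k [p [prat ->]]].
have /choice[f fP] : forall ij : 'I_k.+1 * 'I_d, exists r : rat, p ij.1 0 ij.2 = ratr r.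
  by move=> [i j]; exact: prat.
(* Any common multiple of the denominators of all coordinates works, as the vertices of the dilate
   are among the dilated generators. *)
exists (\prod_ij `|denq (f ij)|)%N; split.
  by rewrite prodn_gt0 // => ij; rewrite absz_gt0 denq_neq0.
move=> v /vertex_dilate_conv[i ->] j; rewrite mxE (fP (i, j)).
rewrite (bigD1 (i, j)) //= natrM mulrAC rpredM ?natr_int //; set r := f _.
have -> : `|denq r|%:R = (denq r)%:~R :> R by rewrite -[in RHS]absz_denq.
by rewrite /ratr mulrC divfK ?intr_int // intr_eq0 denq_neq0.
Qed.

(** Rules out the default value 0 of [denominator]. *)
Lemma denominatorP (P : set 'rV[R]_d) : rational_polytope P ->
  is_denominator P (denominator P).
Proof.
move=> /rational_lattice_dilation qP; apply: (@xgetPex _ 0%N [set q | is_denominator P q]).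
have ex : exists q, `[< lattice_dilation P q >] by have [q] := qP; exists q; apply/asboolP.
case: (ex_minnP ex) => q /asboolP Pq qmin; exists q; split=> // q' Pq'.
by apply: qmin; apply/asboolP.
Qed.

End Vertices.

(** * The cone over a polytope: generators and rank *)

Section ConeOfPolytope.
Variables (R : realType) (d L : nat) (z : 'I_L -> 'rV[R]_d) (e : R).
Hypothesis e_gt0 : 0 < e.
Let P := conv_hull z.

Definition lift1 (x : 'rV[R]_d) : 'rV[R]_(d + 1) := row_mx x (const_mx 1).

Variable U : 'M[R]_(L, d + 1).
Hypothesis rowU : forall i, row i U = e *: lift1 (z i).

Lemma lift1_comb (I : finType) (a : I -> R) (y : I -> 'rV[R]_d) :
  \sum_i a i = 1 -> lift1 (\sum_i a i *: y i) = \sum_i a i *: lift1 (y i).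
Proof.
move=> a1; apply/rowP => j; rewrite summxE !mxE; case: splitP => k jk.
  rewrite summxE; apply: eq_bigr => i _; rewrite !mxE; case: splitP => k' jk'.
    by congr (_ * y i _ _); apply/val_inj; rewrite /= -jk.
  by have := ltn_ord k; rewrite -jk jk' ltnNge leq_addr.
rewrite mxE -a1; apply: eq_bigr => i _; rewrite !mxE; case: splitP => k' jk'.
  by have := ltn_ord k'; rewrite -jk' jk ltnNge leq_addr.
by rewrite mxE mulr1.
Qed.

Lemma cone_in_cone x : P !=set0 -> cone P x <-> in_cone U x.
Proof.
move=> [p0 Pp0]; split=> [[c [p [c0 [a [a0 a1 pE]] xE]]]|[v v0 xE]].
  exists (\row_i (c * a i / e)).
    by move=> i; rewrite mxE divr_ge0 ?mulr_ge0 // ltW.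
  rewrite xE -/(lift1 p) pE lift1_comb // mulmx_sum_row scaler_sumr.
  by apply: eq_bigr => i _; rewrite mxE rowU !scalerA divfK // gt_eqF.
pose A := \sum_i v 0 i.
(* The apex has no point of P to normalize to, so any [p0] is scaled by 0. *)
have [A0|A0] := eqVneq A 0.
  have vz i : v 0 i = 0.
    by move/eqP: A0; rewrite psumr_eq0 // => /allP /(_ i (mem_index_enum _))/eqP.
  exists 0, p0; split=> //; rewrite scale0r xE mulmx_sum_row big1 // => i _.
  by rewrite vz scale0r.
have {}A0 : 0 < A by rewrite lt_def A0 sumr_ge0.
have a1 : \sum_i (v 0 i / A) = 1 by rewrite -mulr_suml divff // gt_eqF.
exists (e * A), (\sum_i (v 0 i / A) *: z i); split.
- by rewrite mulr_ge0 // ltW.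
- by exists (fun i => v 0 i / A); split=> // i; rewrite divr_ge0 // ltW.
- rewrite -/(lift1 _) lift1_comb // scaler_sumr xE mulmx_sum_row.
  apply: eq_bigr => i _; rewrite rowU !scalerA; congr (_ *: _).
  by rewrite -mulrA [A * _]mulrC divfK ?gt_eqF // mulrC.
Qed.

Lemma lift1_sub x : P x -> (lift1 x <= U)%MS.
Proof.
move=> [a [_ a1 ->]]; rewrite lift1_comb // summx_sub // => i _.
have -> : lift1 (z i) = e^-1 *: row i U by rewrite rowU scalerA mulVf ?scale1r // gt_eqF.
by rewrite !scalemx_sub // row_sub.
Qed.

Lemma affine_lift1_sub x : affine_hull P x -> (lift1 x <= U)%MS.
Proof.
move=> [k [p [a [Pp a1 ->]]]]; rewrite lift1_comb // summx_sub // => i _.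
by rewrite scalemx_sub // lift1_sub.
Qed.

Lemma affine_mem x : P x -> affine_hull P x.
Proof.
move=> Px; exists 1%N, (fun=> x), (fun=> 1).
by rewrite !big_ord1 scale1r; split.
Qed.

(** Ensures that [polytope_dim] is not a default value; the directions are spanned by the
    [z i - p0]. *)
Lemma is_dim_exists : P !=set0 -> exists D, is_dim P D.
Proof.
move=> [p0 Pp0].
pose W := <<[seq z i - p0 | i <- enum 'I_L]>>%VS.
exists (\dim W), p0, W; split=> //.
have zW i : z i - p0 \in W.
  by apply: memv_span; apply/mapP; exists i => //; rewrite mem_enum.
have PW x : P x -> x - p0 \in W.
  move=> [a [_ a1 ->]].
  have -> : \sum_i a i *: z i - p0 = \sum_i a i *: (z i - p0).
    by under [RHS]eq_bigr do rewrite scalerBr; rewrite sumrB -scaler_suml a1 scale1r.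
  by apply: memv_suml => i _; apply: memvZ.
rewrite eqEsubset; split=> x.
  move=> [k [p [a [Pp a1 ->]]]]; exists (\sum_i a i *: p i - p0); last by rewrite addrC subrK.
  have -> : \sum_i a i *: p i - p0 = \sum_i a i *: (p i - p0).
    by under [RHS]eq_bigr do rewrite scalerBr; rewrite sumrB -scaler_suml a1 scale1r.
  by apply: memv_suml => i _; apply/memvZ/PW.
move=> [u uW <-].
have [b ->] : exists b : 'I_L -> R, u = \sum_i b i *: (z i - p0).
  have sz : size [seq z i - p0 | i <- enum 'I_L] = L by rewrite size_map size_enum_ord.
  have /coord_span -> : u \in <<in_tuple [seq z i - p0 | i <- enum 'I_L]>>%VS by [].
  exists (fun i => coord (in_tuple [seq z i - p0 | i <- enum 'I_L]) (cast_ord (esym sz) i) u).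
  rewrite (reindex (cast_ord (esym sz))) /=; last first.
    by exists (cast_ord sz) => i _; rewrite ?cast_ordK ?cast_ordKV.
  apply: eq_bigr => i _; congr (_ *: _).
  by rewrite (nth_map i) ?size_enum_ord // nth_ord_enum.
exists L.+1, (fun i => if unlift ord0 i is Some j then z j else p0),
  (fun i => if unlift ord0 i is Some j then b j else 1 - \sum_i b i); split.
- by move=> i; case: (unliftP ord0 i) => [j _|_] //; exact: conv_hull_mem.
- rewrite big_ord_recl unlift_none; under [X in _ + X]eq_bigr do rewrite liftK.
  by rewrite subrK.
- rewrite big_ord_recl unlift_none; under [X in _ = _ + X]eq_bigr do rewrite liftK.
  under [X in _ + X = _]eq_bigr do rewrite scalerBr.
  by rewrite sumrB -scaler_suml scalerBl scale1r addrA addrAC.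
Qed.

Lemma rank_cone D : is_dim P D -> \rank U = (D + 1)%N.
Proof.
move=> [p [W [PE <-]]]; pose D' := \dim W.
pose Bm : 'M[R]_(D', d) := \matrix_i (vbasis W)`_i.
have rowB i : row i Bm = (vbasis W)`_i by rewrite rowK.
have BmW (y : 'rV[R]_D') : y *m Bm = \sum_i y 0 i *: (vbasis W)`_i.
  by rewrite mulmx_sum_row; apply: eq_bigr => i _; rewrite rowB.
have Bfree (y : 'rV[R]_D') : y *m Bm = 0 -> y = 0.
  rewrite BmW => y0; apply/rowP => i; rewrite mxE.
  have /freeP h := basis_free (vbasisP W); exact: (h (fun i => y 0 i)).
(* A basis of the directions at height 0 and one point of the affine hull at height 1: independent
   rows with the same span as [U]. *)
pose M : 'M[R]_(D' + 1, d + 1) := block_mx Bm 0 p (const_mx 1).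
have Mfree : row_free M.
  rewrite -kermx_eq0; apply/eqP/row_matrixP => i; rewrite row0.
  set y := row i _; have : y *m M = 0 by rewrite -row_mul mulmx_ker row0.
  move: y => y; rewrite -[y]hsubmxK mul_row_block mulmx0 add0r.
  have -> : const_mx 1 = 1%:M :> 'M[R]_1 by apply/matrixP => a b; rewrite !mxE !ord1 eqxx.
  rewrite mulmx1 -row_mx0 => /eq_row_mx[y1 y2].
  by move: y1; rewrite y2 mul0mx addr0 => /Bfree ->; rewrite row_mx0.
rewrite -[RHS](eqP Mfree); apply/eqP; rewrite eqn_leq; apply/andP; split; apply: mxrankS.
  apply/row_subP => i; rewrite rowU scalemx_sub //.
  have : affine_hull P (z i) by apply/affine_mem/conv_hull_mem.
  rewrite PE => -[u /= uW <-].
  have -> : lift1 (p + u) = row_mx (\row_i coord (vbasis W) i u) 1%:M *m M.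
    rewrite mul_row_block mulmx0 add0r !mul1mx BmW /lift1; congr (row_mx _ _).
    rewrite addrC; congr (_ + _); rewrite {1}(coord_vbasis uW).
    by apply: eq_bigr => j _; rewrite mxE.
  exact: submxMl.
have pU : (lift1 p <= U)%MS.
  by apply: affine_lift1_sub; rewrite PE; exists 0; rewrite ?addr0 //= mem0v.
rewrite -[M]/(col_mx (row_mx Bm 0) (row_mx p (const_mx 1))) col_mx_sub pU andbT.
apply/row_subP => i; rewrite row_row_mx rowB row0.
have -> : row_mx (vbasis W)`_i 0 = lift1 (p + (vbasis W)`_i) - lift1 p.
  by rewrite /lift1 opp_row_mx add_row_mx addrC addKr subrr.
rewrite addmx_sub // ?eqmx_opp //; apply: affine_lift1_sub; rewrite PE.
by exists (vbasis W)`_i => //=; apply/vbasis_mem/mem_nth; rewrite size_tuple.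
Qed.

End ConeOfPolytope.

(** Dilation by the denominator makes the vertices integral, so the lifted vertices scaled by it are
    lattice generators of one height. *)
Lemma polytope_lattice_cone (R : realType) (d : nat) (P : set 'rV[R]_d) :
  rational_polytope P ->
  exists N (Z : 'M[int]_(N, d + 1)),
  [/\ (0 < denominator P)%N,
      forall i, Z i (rshift d ord0) = (denominator P)%:Z,
      \rank (map_mx (intr : int -> R) Z) = (polytope_dim P + 1)%N
    & forall x, cone P x <-> in_cone (map_mx intr Z) x].
Proof.
move=> ratP; have [[e0 eP] _] := denominatorP ratP.
have [k [p [_ PE]]] := ratP; set e := denominator P in e0 eP *.
have Pn : P !=set0 by rewrite PE; exists (p ord0); exact: conv_hull_mem.
have [L [z [zE zv]]] := conv_hull_vertices p.
have zint i : integral_pt (e%:R *: z i).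
  by apply: eP; apply: vertex_dilate => //; rewrite PE.
pose Z : 'M[int]_(L, d + 1) :=
  (* The entries are already integers; the floor only gives them type [int]. *)
  \matrix_(i, j) Num.floor ((e%:R *: lift1 (z i)) 0 j).
have rowZ i : row i (map_mx intr Z) = e%:R *: lift1 (z i) :> 'rV[R]_(d + 1).
  apply/rowP => j; rewrite 3!mxE; apply/eqP; rewrite -intrEfloor mxE /lift1 mxE.
  case: splitP => l _; first by have := zint i l; rewrite mxE.
  by rewrite mxE mulr1 natr_int.
have {}PE : P = conv_hull z by rewrite zE.
have e0r : 0 < e%:R :> R by rewrite ltr0n.
exists L, Z; split=> //.
- move=> i; rewrite mxE /lift1 mxE mxE; case: splitP => [l /= dl|l _].
    by have := ltn_ord l; rewrite -dl addn0 ltnn.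
  by rewrite mxE mulr1 -[e%:R]/(e%:Z%:~R) intrKfloor.
- apply: (rank_cone e0r rowZ); rewrite -PE; apply: (@xgetPex _ 0%N [set D | is_dim P D]).
  rewrite PE; apply: is_dim_exists; by rewrite -PE.
- by move=> x; rewrite PE; apply: (cone_in_cone e0r rowZ); rewrite -PE.
Qed.

(** * The polynomial h* and the comparison of P with Q *)

Section HStar.
Variables (R : realType) (d : nat).
Local Notation X := 'rV[int]_(d + 1).

Lemma hsum_ge0 (F : X -> R) n : (forall x, 0 <= F x) -> 0 <= hsum htz F n.
Proof. by move=> F0; apply: sumr_ge0. Qed.

Lemma hsum_le (F G : X -> R) n : hfin htz F -> hfin htz G ->
  (forall x, F x <= G x) -> hsum htz F n <= hsum htz G n.
Proof.
move=> fF fG FG; rewrite -subr_ge0 -[X in _ - X]mul1r -mulNr -hsumZ // -hsumD //.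
  by apply: hsum_ge0 => x; rewrite mulN1r subr_ge0.
exact: hfinMl.
Qed.

Lemma Ehr_coefE (P : set 'rV[R]_d) (w : weight R d) N (Z : 'M[int]_(N, d + 1)) (n : nat) :
  (forall x, cone P x <-> in_cone (map_mx intr Z) x) ->
  Ehr_coef P w n = hsum htz (fun x => weval w (realv R x) * cone_ind R Z x) n.
Proof.
move=> PZ; rewrite /Ehr_coef.
have -> : [set x | [/\ cone P x, integral_pt x & last_coord x = n%:R]]
    = [set realv R y | y in [set y : X | htz y = n%:Z /\ in_cone (map_mx intr Z) (realv R y)]].
  rewrite eqEsubset; split=> x /=.
    move=> [Px xi xn]; pose y : X := \row_j Num.floor (x 0 j).
    have yx : realv R y = x.
      by apply/rowP => j; rewrite !mxE; apply/eqP; rewrite -intrEfloor xi.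
    exists y => //; split; last by rewrite yx -PZ.
    by rewrite /htz mxE -/(last_coord x) xn -[n%:R]/(n%:Z%:~R) intrKfloor.
  move=> [y [yn yZ] <-]; split; first by rewrite PZ.
    by move=> j; rewrite mxE intr_int.
  by rewrite /last_coord mxE -/(htz y) yn.
rewrite fsbig_image; last by move=> x y _ _; exact: realv_inj.
rewrite (eq_fsbigr (fun x => weval w (realv R x) * cone_ind R Z x)).
  apply: fsbig_widen => [x []//|x /= [xn nx]]; rewrite /cone_ind asboolF ?mulr0 //.
  by move=> xZ; apply: nx.
by move=> x; rewrite inE => -[_ xZ]; rewrite /cone_ind asboolT // mulr1.
Qed.

Lemma cone_ht_ge0 N (Z : 'M[int]_(N, d + 1)) (e : nat) x :
  (forall i, Z i (rshift d ord0) = e%:Z) ->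
  in_cone (map_mx (intr : int -> R) Z) (realv R x) -> 0 <= htz x.
Proof.
move=> Ze [v v0 E]; rewrite -(ler0z R) (ht_mulU Ze E) mulr_ge0 ?ler0n //.
exact: sumr_ge0.
Qed.

Definition Ehr_fun N (Z : 'M[int]_(N, d + 1)) (w : weight R d) : int -> R :=
  hsum htz (fun x => weval w (realv R x) * cone_ind R Z x).

Definition Ehr_open N (Z : 'M[int]_(N, d + 1)) (q : 'rV[R]_N) (w : weight R d) : int -> R :=
  hsum htz (fun x => weval w (realv R x) * open_ind Z q x).

Lemma in_cone_shift N (U : 'M[R]_(N, d + 1)) (q : 'rV[R]_N) x :
  (forall i, 0 < q 0 i) ->
  (exists2 ep, 0 < ep & in_cone U (x - ep *: (q *m U))) -> in_cone U x.
Proof.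
move=> q0 [ep ep0 [v v0 E]].
exists (v + ep *: q); last by rewrite mulmxDl -E -scalemxAl subrK.
by move=> i; rewrite !mxE addr_ge0 // mulr_ge0 // ltW.
Qed.

(** The open sums vanish at negative heights, so by reciprocity the differences of the Ehrhart
    coefficients vanish beyond [e * r]. They are therefore the coefficients of a polynomial, and the
    open series has the reversed polynomial as numerator. *)
Lemma hstar_spec (P : set 'rV[R]_d) (w : weight R d) m :
  rational_polytope P -> homogeneous m w ->
  exists N (Z : 'M[int]_(N, d + 1)) (q : 'rV[R]_N),
  let e := denominator P in let r := (polytope_dim P + m + 1)%N in
  [/\ [/\ (0 < e)%N, forall i, Z i (rshift d ord0) = e%:Z, forall i, 0 < q 0 i,
          \rank (map_mx (intr : int -> R) Z) = (polytope_dim P + 1)%N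
        & forall x, cone P x <-> in_cone (map_mx intr Z) x],
      [/\ forall n, n < 0 -> Ehr_fun Z w n = 0 & forall n, n < 0 -> Ehr_open Z q w n = 0],
      forall n : nat, iter r (bdiff e) (Ehr_fun Z w) n = (hstar P w m)`_n,
      (size (hstar P w m) <= (e * r).+1)%N
    & forall n : nat, iter r (bdiff e) (Ehr_open Z q w) n
        = (if (n <= e * r)%N then (hstar P w m)`_(e * r - n)%N else 0)].
Proof.
move=> ratP wm; have [N [Z [e0 Ze rk PZ]]] := polytope_lattice_cone ratP.
have [q q0 rec] := cone_reciprocity R e0 Ze.
exists N, Z, q => e r.
have rE : (\rank (map_mx (intr : int -> R) Z) + m = r)%N by rewrite rk /r; lia.
have {}rec n : iter r (bdiff e) (Ehr_fun Z w) n
    = iter r (bdiff e) (Ehr_open Z q w) ((e * r)%:Z - n).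
  rewrite -rE; apply: rec; first exact: weval_deg.
  by move=> x; rewrite realvN (wevalN _ wm).
have neg1 n : n < 0 -> Ehr_fun Z w n = 0.
  move=> n0; apply: fsbig1 => x /= hx; rewrite /cone_ind asboolF ?mulr0 //.
  by move/(cone_ht_ge0 Ze); rewrite hx; lia.
have neg2 n : n < 0 -> Ehr_open Z q w n = 0.
  move=> n0; apply: fsbig1 => x /= hx; rewrite /open_ind asboolF ?mulr0 //.
  by move/(in_cone_shift q0)/(cone_ht_ge0 Ze); rewrite hx; lia.
pose h := \poly_(n < (e * r).+1) iter r (bdiff e) (Ehr_fun Z w) n%:Z.
have hE (n : nat) : iter r (bdiff e) (Ehr_fun Z w) n = h`_n.
  rewrite coef_poly; case: ltnP => // ne.
  by rewrite rec (iter_bdiff_neg _ _ neg2) //; lia.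
have conv (n : nat) : \sum_(i < n.+1) ((1 - 'X^e) ^+ r)`_i * Ehr_coef P w (n - i)
    = iter r (bdiff e) (Ehr_fun Z w) n.
  by apply: iter_bdiff_convolution => // k; rewrite (Ehr_coefE _ _ PZ).
have hh : hstar P w m = h.
  have hP : is_hstar P w m h by move=> n; rewrite -/e -/r conv hE.
  (* The defining identity determines every coefficient, so the chosen polynomial is [h]. *)
  apply/polyP => n; have := @xgetPex _ 0 [set h | is_hstar P w m h] (ex_intro _ h hP) n.
  by rewrite -/(hstar P w m) => <-; apply: hP.
rewrite hh; split=> //; first exact: size_poly.
move=> n; case: leqP => ne.
  by rewrite -hE rec; congr (iter _ _ _ _); lia.
have -> : n%:Z = (e * r)%:Z - ((e * r)%:Z - n%:Z) by lia.
by rewrite -rec (iter_bdiff_neg _ _ neg1) //; lia.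
Qed.

Lemma geom_sumE (e g : nat) (t : R) : (e %| g)%N ->
  (1 - t ^+ e) * geom_sum e g t = 1 - t ^+ g.
Proof.
move=> eg; rewrite /geom_sum -[in RHS](divnK eg); elim: (g %/ e)%N => [|k IH].
  by rewrite big_ord0 mulr0 mul0n subrr.
by rewrite big_ord_recr /= mulrDr IH mulSn exprD; ring.
Qed.

(** Equal ranks force equal spans, so the interior vector of the larger cone is a combination [b] of
    the generators of the smaller one, and a small multiple of [b] is absorbed by the slack
    [ep *: q1]. *)
Lemma open_sub N1 N2 (U1 : 'M[R]_(N1, d + 1)) (U2 : 'M[R]_(N2, d + 1))
    (q1 : 'rV[R]_N1) (q2 : 'rV[R]_N2) x :
  (forall y, in_cone U1 y -> in_cone U2 y) -> \rank U1 = \rank U2 ->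
  (forall i, 0 < q1 0 i) ->
  (exists2 ep, 0 < ep & in_cone U1 (x - ep *: (q1 *m U1))) ->
  (exists2 ep, 0 < ep & in_cone U2 (x - ep *: (q2 *m U2))).
Proof.
move=> sub rk q10 [ep ep0 xin].
have U12 : (U1 <= U2)%MS.
  apply/row_subP => i; have [|v _ ->] := sub (row i U1); last exact: submxMl.
  exists (delta_mx 0 i); last by rewrite rowE.
  by move=> j; rewrite mxE ler0n.
have /andP[_ U21] : (U1 == U2)%MS.
  by rewrite -(geq_leqif (mxrank_leqif_eq U12)) rk.
have [b bE] : exists b : 'rV[R]_N1, q2 *m U2 = b *m U1.
  by apply/submxP; apply: submx_trans U21; exact: submxMl.
have [ep' ep'0 epP] : exists2 ep' : R, 0 < ep' & forall i e', 0 < e' -> e' <= ep' ->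
    0 <= ep * q1 0 i - e' * b 0 i.
  apply: small_all => i; have [bi|bi] := leP (b 0 i) 0.
    by exists 1 => // e' e'0 _; have := mulr_gt0 ep0 (q10 i); nra.
  exists (ep * q1 0 i / b 0 i); first by rewrite divr_gt0 // mulr_gt0.
  by move=> e' _; rewrite ler_pdivlMr // subr_ge0.
exists ep' => //; apply: sub.
have [v v0 vE] := xin.
exists (v + (ep *: q1 - ep' *: b)).
  by move=> i; rewrite mxE addr_ge0 //; have := epP i ep' ep'0 (lexx _); rewrite !mxE.
by rewrite mulmxDl -vE mulmxBl -!scalemxAl -bE addrA subrK.
Qed.

End HStar.

Theorem theorem2p9 (R : realType) (d : nat) (P Q : set 'rV[R]_d) (D : nat)
  (ratP : rational_polytope P) (ratQ : rational_polytope Q)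
  (dimP : polytope_dim P = D) (dimQ : polytope_dim Q = D) (subPQ : P `<=` Q)
  (m : nat) (w : weight R d)
  (wS : S_semiring Q w) (w_homog : homogeneous m w) :
  (forall g : nat, (0 < g)%N -> (denominator P %| g)%N -> (denominator Q %| g)%N ->
     forall t : R, 0 <= t ->
       geom_sum (denominator P) g t ^+ (D + m + 1) * (hstar P w m).[t]
       <= geom_sum (denominator Q) g t ^+ (D + m + 1) * (hstar Q w m).[t])
  /\ (denominator P = denominator Q ->
      forall t : R, 0 <= t -> (hstar P w m).[t] <= (hstar Q w m).[t]).
Proof.
have [N1 [Z1 [q1 [[e10 Z1e q10 rk1 PZ1] [neg1 neg1o] h1 sz1 h1o]]]] := hstar_spec ratP w_homog.
have [N2 [Z2 [q2 [[e20 Z2e q20 rk2 PZ2] [neg2 neg2o] h2 sz2 h2o]]]] := hstar_spec ratQ w_homog.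
rewrite dimP dimQ in rk1 rk2 h1 h1o h2 h2o sz1 sz2.
set e1 := denominator P in e10 Z1e h1 h1o sz1 *.
set e2 := denominator Q in e20 Z2e h2 h2o sz2 *.
set r := (D + m + 1)%N in h1 h1o h2 h2o sz1 sz2 *.
set H1 := hstar P w m in h1 h1o sz1 *; set H2 := hstar Q w m in h2 h2o sz2 *.
have subZ (y : 'rV[R]_(d + 1)) : in_cone (map_mx intr Z1) y -> in_cone (map_mx intr Z2) y.
  move=> /PZ1 [c [p [c0 Pp yE]]]; apply/PZ2; exists c, p; split=> //; exact: subPQ.
have w0 (x : 'rV[R]_(d + 1)) : in_cone (map_mx intr Z2) x -> 0 <= weval w x.
  by move=> /PZ2; exact: S_semiring_ge0.
have le_cone n : Ehr_fun Z1 w n <= Ehr_fun Z2 w n.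
  apply: hsum_le; [exact/hfinMl/(cone_fin R e10)|exact/hfinMl/(cone_fin R e20)|].
  move=> x; rewrite /cone_ind; case: asboolP => [x1|_].
    by rewrite asboolT //; exact: subZ.
  by case: asboolP => [/w0|_]; rewrite ?mulr1 mulr0.
have le_open n : Ehr_open Z1 q1 w n <= Ehr_open Z2 q2 w n.
  apply: hsum_le; [exact/hfinMl/(open_fin e10)|exact/hfinMl/(open_fin e20)|].
  move=> x; rewrite /open_ind; case: asboolP => [x1|_].
    by rewrite asboolT //; apply: open_sub x1 => //; rewrite rk1 rk2.
  by case: asboolP => [/(in_cone_shift q20)/w0|_]; rewrite ?mulr1 mulr0.
have psum_le f1 f2 t n : (forall n, f1 n <= f2 n) -> 0 <= t -> psum f1 t n <= psum f2 t n.
  by move=> f12 t0; apply: ler_sum => i _; rewrite ler_wpM2r // exprn_ge0.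
have lt1 (t : R) : 0 <= t -> t < 1 ->
    H1.[t] / (1 - t ^+ e1) ^+ r <= H2.[t] / (1 - t ^+ e2) ^+ r.
  move=> t0 t1; apply: tends_le (psum_lim neg1 e10 t0 t1 h1) (psum_lim neg2 e20 t0 t1 h2).
  by move=> n; apply: psum_le.
have gt1 (t : R) : 1 < t ->
    H1.[t] / (t ^+ e1 - 1) ^+ r <= H2.[t] / (t ^+ e2 - 1) ^+ r.
  move=> t1; have t0 : 0 < t by lra.
  (* The reversal is taken in degree [e * r], whatever the degree of [H], so that its value at 1/t
     is H(t) / t^(e r) and the denominators match. *)
  pose rev e (H : {poly R}) := \poly_(n < (e * r).+1) H`_(e * r - n)%N.
  have revE e (H : {poly R}) : (size H <= (e * r).+1)%N -> (0 < e)%N ->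
      (rev e H).[t^-1] / (1 - t^-1 ^+ e) ^+ r = H.[t] / (t ^+ e - 1) ^+ r.
    move=> szH e0; have te : t ^+ e != 0 by rewrite expf_neq0 // gt_eqF.
    have -> : 1 - t^-1 ^+ e = (t ^+ e - 1) / t ^+ e by rewrite exprVn mulrBl divff // mul1r.
    rewrite expr_div_n invf_div mulrA; congr (_ / _).
    rewrite horner_poly (horner_coef_wide _ szH) mulr_suml (reindex_inj rev_ord_inj) /=.
    apply: eq_bigr => i _; rewrite subSS subKn; last by rewrite -ltnS.
    rewrite -mulrA -exprM exprVn [_^-1 * _]mulrC -exprB ?leq_subr ?unitfE ?gt_eqF //.
    by rewrite subKn // -ltnS.
  rewrite -!revE //; apply: tends_le (psum_lim neg1o e10 _ _ _) (psum_lim neg2o e20 _ _ _).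
  - by move=> n; apply: psum_le => //; rewrite invr_ge0 ltW.
  - by rewrite invr_ge0 ltW.
  - by rewrite invf_lt1.
  - by move=> n; rewrite h1o coef_poly ltnS.
  - by rewrite invr_ge0 ltW.
  - by rewrite invf_lt1.
  - by move=> n; rewrite h2o coef_poly ltnS.
have main g : (0 < g)%N -> (e1 %| g)%N -> (e2 %| g)%N -> forall t : R, 0 <= t -> t != 1 ->
    geom_sum e1 g t ^+ r * H1.[t] <= geom_sum e2 g t ^+ r * H2.[t].
  move=> g0 g1 g2 t t0 tn1.
  have geomE e : (0 < e)%N -> (e %| g)%N -> geom_sum e g t = (1 - t ^+ g) / (1 - t ^+ e).
    move=> e0 eg; apply: (canRL (mulfK _)); last by rewrite mulrC geom_sumE.
    by rewrite subr_eq0 eq_sym pexpr_eq1.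
  rewrite !geomE //; have [t1|t1|t1] := ltgtP t 1; last by rewrite t1 eqxx in tn1.
    rewrite !expr_div_n -!mulrA ler_wpM2l //.
      by rewrite exprn_ge0 // subr_ge0 exprn_ile1 // ltW.
    by rewrite ![_^-1 * _]mulrC; exact: lt1.
  (* For t > 1 the common factor must be t^g - 1, so that its [r]-th power is nonnegative for either
     parity of [r]. *)
  have sgn e : (1 - t ^+ g) / (1 - t ^+ e) = (t ^+ g - 1) / (t ^+ e - 1).
    by rewrite -[1 - _]opprB -[1 - t ^+ e]opprB invrN mulrNN.
  rewrite !sgn !expr_div_n -!mulrA ler_wpM2l //.
    by rewrite exprn_ge0 // subr_ge0 exprn_ege1 // ltW.
  by rewrite ![_^-1 * _]mulrC; exact: gt1.
have main1 g : (0 < g)%N -> (e1 %| g)%N -> (e2 %| g)%N -> forall t : R, 0 <= t ->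
    geom_sum e1 g t ^+ r * H1.[t] <= geom_sum e2 g t ^+ r * H2.[t].
  move=> g0 g1 g2 t t0; have [->|] := eqVneq t 1; last exact: main.
  pose G e : {poly R} := \sum_(i < g %/ e) 'X^(i * e).
  have GE e s : (G e).[s] = geom_sum e g s.
    by rewrite horner_sum; apply: eq_bigr => i _; rewrite hornerXn.
  have := @horner_ge0_at1 R (G e2 ^+ r * H2 - G e1 ^+ r * H1).
  rewrite !hornerE !GE subr_ge0; apply=> s s0 s1.
  by rewrite !hornerE !GE subr_ge0 main // lt_eqF.
(* With equal denominators one takes g = delta(P), and both geometric sums reduce to 1. *)
split=> // e12 t t0; have := main1 e1 e10 (dvdnn _).
rewrite -e12 => /(_ (dvdnn _) t t0); rewrite /geom_sum divnn e10 !big_ord1 !expr0 !expr1n.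
by rewrite !mul1r.
Qed.
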